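(* Let $\lambda=\sum_{i=1}^n m_i\omega_i$ be a dominant integral weight of $\mathfrak{sl}_{n+1}(\mathbb{C})$. (i) For each $\mathbf{s}\in S(\lambda)$ fix an arbitrary order of the factors $f_\alpha$ in the product $\prod_{\alpha>0}f_\alpha^{s_\alpha}$, and let $f^{\mathbf{s}}=\prod_{\alpha>0}f_\alpha^{s_\alpha}\in U(\mathfrak{n}^-)$ be the ordered product. Then the elements $f^{\mathbf{s}}v_\lambda$, $\mathbf{s}\in S(\lambda)$, form a basis of $V(\lambda)$. (ii) $\dim V(\lambda)=\# S(\lambda)$. (iii) $\mathrm{char}\,V(\lambda)=\sum_{\mathbf{s}\in S(\lambda)}e^{\lambda-\mathrm{wt}(\mathbf{s})}$.
   Context: Let $\mathfrak{g}=\mathfrak{sl}_{n+1}(\mathbb{C})=\mathfrak{n}^+\oplus\mathfrak{h}\oplus\mathfrak{n}^-$ be a Cartan decomposition, with simple roots $\alpha_1,\dots,\alpha_n$ and fundamental weights $\omega_1,\dots,\omega_n$. The positive roots are $\alpha_{p,q}=\alpha_p+\dots+\alpha_q$, $1\le p\le q\le n$ (so $\alpha_{i,i}=\alpha_i$). For each positive root $\alpha$ fix a nonzero root vector $f_\alpha\in\mathfrak{n}^-_{-\alpha}$. $V(\lambda)$ is the irreducible $\mathfrak{g}$-module of highest weight $\lambda$, with highest weight vector $v_\lambda$; $\mathrm{char}\,V(\lambda)=\sum_\mu \dim V(\lambda)^\mu\, e^\mu$, where $V(\lambda)^\mu$ is the $\mu$-weight space. A multi-exponent is a tuple $\mathbf{s}=(s_\alpha)_{\alpha>0}$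 of non-negative integers indexed by the positive roots; write $s_{j,k}=s_{\alpha_{j,k}}$. Its weight is $\mathrm{wt}(\mathbf{s})=\sum_{1\le j\le k\le n}s_{j,k}\alpha_{j,k}$. A Dyck path is a sequence $\mathbf{p}=(\beta(0),\dots,\beta(k))$, $k\ge0$, of positive roots such that either $k=0$ and $\mathbf{p}=(\alpha_i)$ for some simple root $\alpha_i$, or $k\ge1$, $\beta(0)=\alpha_i$, $\beta(k)=\alpha_j$ for some $1\le i<j\le n$, and whenever $\beta(s)=\alpha_{p,q}$ with $s<k$, then $\beta(s+1)=\alpha_{p,q+1}$ or $\beta(s+1)=\alpha_{p+1,q}$. For $\lambda=\sum m_i\omega_i$ dominant integral, $S(\lambda)$ is the set of all multi-exponents $\mathbf{s}$ such that for every Dyck path $\mathbf{p}=(\beta(0),\dots,\beta(k))$ with $\beta(0)=\alpha_i$, $\beta(k)=\alpha_j$ one has $s_{\beta(0)}+\dots+s_{\beta(k)}\le m_i+m_{i+1}+\dots+m_j$. *)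

(* Defs.v *)
From HB Require Import structures.
From mathcomp Require Import all_boot all_order all_algebra.
From mathcomp Require Import finmap monalg complex.
From mathcomp Require Import boolp classical_sets cardinality reals.

Set Implicit Arguments.
Unset Strict Implicit.
Unset Printing Implicit Defensive.

Import GRing.Theory.
Local Open Scope classical_set_scope.
Local Open Scope ring_scope.

(* The index i : 'I_n (0-based) stands for the node i+1 of the Dynkin diagram
   A_n.  The two standard coordinates attached to it are row i and row i+1 of
   an (n+1) x (n+1) matrix. *)
Definition lo n (i : 'I_n) : 'I_n.+1 := widen_ord (leqnSn n) i.
Definition hi n (i : 'I_n) : 'I_n.+1 := lift ord0 i.

Section SpecialLinear.
Variables (C : fieldType) (n : nat).
Local Notation M := 'M[C]_n.+1.

Definition bracket (x y : M) : M := x *m y - y *m x.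

Definition sl : set M := [set x | \tr x = 0].
Definition cartan : set M := sl `&` [set x | is_diag_mx x].
Definition nplus : set M := [set x | forall i j : 'I_n.+1, (j <= i)%N -> x i j = 0].
Definition nminus : set M := [set x | forall i j : 'I_n.+1, (i <= j)%N -> x i j = 0].

(* A weight, i.e. an element of the dual of the Cartan subalgebra, is given by
   its coordinates in the basis of fundamental weights, which are also its
   values on the simple coroots. *)
Definition weight := 'rV[C]_n.

Definition coroot (i : 'I_n) : M :=
  delta_mx (lo i) (lo i) - delta_mx (hi i) (hi i).

Definition omega (i : 'I_n) : weight := delta_mx 0 i.

(* omega_i maps a traceless diagonal h to h_0 + ... + h_i. *)
Definition wt_eval (mu : weight) (h : M) : C :=
  \sum_(i < n) mu 0 i * \sum_(j < n.+1 | (j <= i)%N) h j j.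

Lemma wt_eval_coroot mu i : wt_eval mu (coroot i) = mu 0 i.
Proof.
rewrite /wt_eval (bigD1 i) //= [X in _ + X]big1 ?addr0 => [|k ki].
  rewrite (bigD1 (lo i)) //= big1 => [|j /andP[ji jNi]].
    rewrite !mxE !eqxx /= -val_eqE /= /bump leq0n add1n.
    by rewrite (ltn_eqF (ltnSn i)) subr0 addr0 mulr1.
  rewrite !mxE (negPf jNi) /= -val_eqE /= /bump leq0n add1n.
  by rewrite (ltn_eqF (leq_ltn_trans ji (ltnSn i))) subr0.
case: (ltngtP k i) => [ltki|ltik|/val_inj eki]; last by rewrite eki eqxx in ki.
  rewrite big1 ?mulr0 // => j jk; rewrite !mxE -!val_eqE /= /bump leq0n add1n.
  rewrite (ltn_eqF (leq_ltn_trans jk ltki)).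
  by rewrite (ltn_eqF (leq_ltn_trans jk (ltn_trans ltki (ltnSn i)))) subr0.
rewrite (bigD1 (lo i)) /= ?(ltnW ltik) // (bigD1 (hi i)) /=; last first.
  by rewrite -val_eqE /= /bump leq0n add1n ltik gtn_eqF.
rewrite big1 ?addr0 => [|j /andP[/andP[_ jl] jh]].
  rewrite !mxE !eqxx /= -!val_eqE /= /bump leq0n add1n.
  by rewrite (ltn_eqF (ltnSn i)) (gtn_eqF (ltnSn i)) subr0 sub0r subrr mulr0.
by rewrite !mxE (negPf jl) (negPf jh) subr0.
Qed.

(* The simple root h |-> h_i - h_(i+1), see alpha_eval. *)
Definition alpha (j : 'I_n) : weight :=
  \row_i (coroot i (lo j) (lo j) - coroot i (hi j) (hi j)).

Lemma alpha_eval j h : cartan h ->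
  wt_eval (alpha j) h = h (lo j) (lo j) - h (hi j) (hi j).
Proof.
move=> [trh _]; pose T k := \sum_(l < n.+1 | (l <= k)%N) h l l.
have Tn : T n = 0.
  rewrite -[RHS]trh /T /mxtrace; apply: eq_bigl => l.
  by rewrite -ltnS ltn_ord.
have eq0 (k : 'I_n.+1) : \sum_(i < n) T i * (k == lo i)%:R = T k.
  case: (unliftP ord_max k) => [l ->|->]; last first.
    rewrite Tn big1 // => i _.
    by rewrite -val_eqE /= gtn_eqF ?ltn_ord // mulr0.
  have -> : lift ord_max l = lo l by apply/val_inj; rewrite /= /bump leqNgt ltn_ord.
  rewrite (bigD1 l) //= eqxx mulr1 big1 ?addr0 // => i il.
  by rewrite -val_eqE /= val_eqE eq_sym (negPf il) mulr0.
have TE (k : 'I_n.+1) : h k k = \sum_(i < n) T i * coroot i k k.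
  under eq_bigr => i _ do rewrite !mxE !andbb mulrBr.
  rewrite sumrB eq0; case: (unliftP ord0 k) => [l ->|->].
    rewrite (bigD1 l) //= eqxx mulr1 big1 ?addr0 => [|i il]; last first.
      by rewrite -val_eqE /= /bump /= eqSS val_eqE eq_sym (negPf il) mulr0.
    suff -> : T (lift ord0 l) = h (lift ord0 l) (lift ord0 l) + T l by rewrite addrK.
    rewrite {1}/T (bigD1 (lift ord0 l)) //=; congr (_ + _); apply: eq_bigl => i.
    by rewrite -val_eqE /= /bump /= add1n andbC -ltn_neqAle ltnS.
  rewrite [X in _ - X]big1 ?subr0 => [|i _]; last first.
    by rewrite -val_eqE /= mulr0.
  rewrite /T (bigD1 ord0) //= big1 ?addr0 // => i /andP[].
  by rewrite leqn0 -val_eqE => ->.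
rewrite !TE -sumrB /wt_eval; apply: eq_bigr => i _.
by rewrite mxE mulrC mulrBr.
Qed.

End SpecialLinear.

(* The positive root alpha_(p,q) = alpha_p + ... + alpha_q as the pair (p, q). *)
Definition posroot n := {pq : 'I_n * 'I_n | (pq.1 <= pq.2)%N}.
HB.instance Definition _ n := Finite.on (posroot n).

Definition posroot_weight (C : fieldType) n (a : posroot n) : weight C n :=
  \sum_(k < n | ((val a).1 <= k <= (val a).2)%N) alpha C k.

Definition is_simple n (a : posroot n) (i : 'I_n) : bool := val a == (i, i).

(* Nonzero elements of the root space of weight -a in n^-. *)
Definition neg_root_vector (C : fieldType) n (a : posroot n) (x : 'M[C]_n.+1) :=
  [/\ nminus x, x <> 0 &
      forall h, cartan h -> bracket h x = - wt_eval (posroot_weight C a) h *: x].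

Section Modules.
Variables (C : fieldType) (n : nat) (V : lmodType C).
Variable rho : 'M[C]_n.+1 -> V -> V.

(* rho is a representation of sl_(n+1); its values outside sl are junk. *)
Definition is_rep : Prop :=
  [/\ forall x, sl x -> linear (rho x),
      forall c x y u, sl x -> sl y -> rho (c *: x + y) u = c *: rho x u + rho y u &
      forall x y u, sl x -> sl y ->
        rho (bracket x y) u = rho x (rho y u) - rho y (rho x u)].

Definition submodule (W : set V) : Prop :=
  [/\ W 0, forall c u w, W u -> W w -> W (c *: u + w) &
      forall x u, sl x -> W u -> W (rho x u)].

Definition irreducible : Prop :=
  (exists u : V, u <> 0) /\
  forall W, submodule W -> W = [set 0] \/ W = setT.

Definition weight_space (mu : weight C n) : set V :=
  [set u | forall h, cartan h -> rho h u = wt_eval mu h *: u].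

Definition highest_weight_vector (mu : weight C n) (v : V) : Prop :=
  [/\ v <> 0, weight_space mu v & forall x, nplus x -> rho x v = 0].

(* The action on v of the monomial f_(w_1) f_(w_2) ... f_(w_r) of U(n^-). *)
Definition monomial_act (f : posroot n -> 'M[C]_n.+1) (w : seq (posroot n))
    (v : V) : V :=
  foldr (fun a u => rho (f a) u) v w.

End Modules.

Section Bases.
Variables (C : fieldType) (V : lmodType C).

(* The family (b i), i in S, is a basis of the subspace A. *)
Definition is_basis (A : set V) (I : choiceType) (S : set I) (b : I -> V) : Prop :=
  [/\ forall i, S i -> A (b i),
      forall (F : {fset I}) (c : I -> C), [set` F] `<=` S ->
        \sum_(i <- F) c i *: b i = 0 -> forall i, i \in F -> c i = 0 &
      forall u, A u -> exists (F : {fset I}) (c : I -> C),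
        [set` F] `<=` S /\ u = \sum_(i <- F) c i *: b i].

Definition has_dim (A : set V) (d : nat) : Prop :=
  exists b : 'I_d -> V, is_basis A setT b.

End Bases.

(* Characters live in the group of finitely supported functions
   weight C n -> int; <<mu>> is the formal exponential e^mu. *)
Definition is_char (C : fieldType) n (V : lmodType C)
    (rho : 'M[C]_n.+1 -> V -> V) (ch : {malg int[weight C n]}) : Prop :=
  forall mu, exists2 d : nat, has_dim (weight_space rho mu) d & ch@_mu = d%:Z.

Section MultiExponents.
Variable n : nat.

Definition multiexp := {ffun posroot n -> nat}.
HB.instance Definition _ := Choice.on multiexp.

Definition wt (C : fieldType) (s : multiexp) : weight C n :=
  \sum_(a : posroot n) posroot_weight C a *+ s a.

Definition dyck_step (a b : posroot n) : bool :=
  let: (p, q) := val a in let: (p', q') := val b in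
  (p' == p) && (q' == q.+1 :> nat) || (p' == p.+1 :> nat) && (q' == q).

(* Dyck paths from alpha_i to alpha_j. *)
Definition dyck_path (i j : 'I_n) (p : seq (posroot n)) : bool :=
  if p is b0 :: p' then
    [&& is_simple b0 i, is_simple (last b0 p') j, path dyck_step b0 p'
      & nilp p' || (i < j)%N]
  else false.

Definition S_lambda (m : 'I_n -> nat) : set multiexp :=
  [set s | forall (i j : 'I_n) (p : seq (posroot n)), dyck_path i j p ->
    (\sum_(b <- p) s b <= \sum_(k < n | (i <= k <= j)%N) m k)%N].

Definition dominant_weight (C : fieldType) (m : 'I_n -> nat) : weight C n :=
  \sum_(i < n) omega C i *+ m i.

End MultiExponents.

(* Main.v *)
Require Import Defs.
(** Spanning follows Feigin, Fourier and Littelmann: if a Dyck path p from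
    alpha_i to alpha_j is violated by s, the power f_(i,j)^N v with N the sum of
    s over p vanishes.  Acting on it by n^+ and dropping shorter words turns it
    into the sum over sigma of the words with letters f_(x_k, y_(sigma k)), where
    the (x_k, y_k) are the roots of p repeated according to s.  Since p is a chain,
    the identity matching strictly maximizes the sum of x_k * y_(sigma k), so f^s v
    is rewritten in terms of shorter words and of words of smaller such sum.

    For independence, S(lambda) is a Minkowski sum of sets S(omega_i) and v is
    modelled by the tensor product v_T of the highest weight vectors of the
    exterior powers.  For s in S(omega_i), an antichain, the words with a nonzero
    coefficient at the extremal basis tensor attached to s have cost at least that
    of s, for an additive cost on multidegrees, with equality only in multidegree
    s; this triangularity passes to tensor products, whatever the order of the
    factors.

    The submodule of V x T generated by (v, v_T) is the graph of an isomorphism: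
    its kernel on V is trivial as V is irreducible, and its kernel on T is
    trivial because it is orthogonal, for a contravariant positive definite
    Hermitian form, to the submodule generated by v_T.  Hence linear relations
    between words transfer between V and T; in particular f_(i,j)^N v = 0 need
    only be checked in T. *)
From HB Require Import structures.
From mathcomp Require Import all_boot all_order all_algebra fingroup perm.
From mathcomp Require Import finmap monalg complex.
From mathcomp Require Import boolp classical_sets cardinality reals.
From mathcomp Require Import zify ring.
Set Implicit Arguments.
Unset Strict Implicit.
Unset Printing Implicit Defensive.
Import Order.TTheory GRing.Theory Num.Theory.
Local Open Scope ring_scope.

(** * Highest weight modules and the PBW filtration *)

Section GLRep.
Variables (C : numFieldType) (n : nat).
Local Notation M := 'M[C]_n.+1.
Implicit Types (x y e : M).

Definition gl_rep (V : lmodType C) (rho : M -> V -> V) : Prop :=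
  [/\ forall x, linear (rho x),
      forall c x y u, rho (c *: x + y) u = c *: rho x u + rho y u &
      forall x y u, rho (bracket x y) u = rho x (rho y u) - rho y (rho x u)].

Definition traceless x : M := x - (\tr x / n.+1%:R)%:M.

Lemma traceless_sl x : sl (traceless x).
Proof.
rewrite /sl /= /traceless raddfB /= mxtrace_scalar -[_ / _ *+ _]mulr_natr.
by rewrite divfK ?subrr // pnatr_eq0.
Qed.

Lemma traceless_id x : sl x -> traceless x = x.
Proof. by rewrite /sl /= /traceless => ->; rewrite mul0r raddf0 subr0. Qed.

Lemma traceless_linear : linear traceless.
Proof.
move=> c x y; rewrite /traceless mxtraceD mxtraceZ mulrDl raddfD /= -mulrA.
by rewrite -scale_scalar_mx scalerBr opprD addrACA.
Qed.

Lemma bracket_sl x y : sl (bracket x y).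
Proof. by rewrite /sl /= /bracket raddfB /= mxtrace_mulC subrr. Qed.

Lemma bracket_traceless x y : bracket (traceless x) (traceless y) = bracket x y.
Proof.
rewrite /bracket /traceless !mulmxBl !mulmxBr.
rewrite !(mul_scalar_mx, mul_mx_scalar) !scale_scalar_mx.
set a := _ / _; set b := _ / _; rewrite [b * a]mulrC.
rewrite !opprB !addrA; apply/eqP; rewrite -subr_eq0; apply/eqP/matrixP=> i j.
rewrite !mxE; set u := \sum_k _; set w := \sum_k _; ring.
Qed.

Section OneRep.
Variables (V : lmodType C) (rho : M -> V -> V).

(* Extending to gl_(n+1) through the traceless part removes all membership side
   conditions; on sl_(n+1) nothing changes. *)
Definition gl_ext x u := rho (traceless x) u.

Lemma gl_ext_sl x u : sl x -> gl_ext x u = rho x u.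
Proof. by move=> slx; rewrite /gl_ext traceless_id. Qed.

(** Scalar matrices are central, so replacing both arguments by their traceless parts does not
    change a bracket, which is itself traceless. *)
Lemma gl_ext_rep : is_rep rho -> gl_rep gl_ext.
Proof.
move=> [lin lin2 br]; split=> [x|c x y u|x y u].
- exact/lin/traceless_sl.
- by rewrite /gl_ext traceless_linear lin2 //; exact: traceless_sl.
- rewrite /gl_ext -br; [|exact: traceless_sl..].
  by rewrite bracket_traceless traceless_id //; exact: bracket_sl.
Qed.

Hypothesis rhoP : gl_rep rho.

Lemma repL c x u w : rho x (c *: u + w) = c *: rho x u + rho x w.
Proof. by case: rhoP => h _ _; rewrite h. Qed.

Lemma rep0 x : rho x 0 = 0.
Proof.
have := repL 1 x 0 0; rewrite !scale1r addr0 => /eqP.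
by rewrite -subr_eq subrr => /eqP.
Qed.

Lemma repD x u w : rho x (u + w) = rho x u + rho x w.
Proof. by have := repL 1 x u w; rewrite !scale1r. Qed.

Lemma repZ x c u : rho x (c *: u) = c *: rho x u.
Proof. by have := repL c x u 0; rewrite rep0 !addr0. Qed.

Lemma repN x u : rho x (- u) = - rho x u.
Proof. by rewrite -scaleN1r repZ scaleN1r. Qed.

Lemma repB x u w : rho x (u - w) = rho x u - rho x w.
Proof. by rewrite repD repN. Qed.

Lemma rep_sum I (r : seq I) (P : pred I) F x :
  rho x (\sum_(i <- r | P i) F i) = \sum_(i <- r | P i) rho x (F i).
Proof.
apply: (big_rec2 (fun a b => rho x a = b)) => [|i a b _ <-]; first exact: rep0.
by rewrite repD.
Qed.

Lemma rep_mxL c x y u : rho (c *: x + y) u = c *: rho x u + rho y u.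
Proof. by case: rhoP. Qed.

Lemma rep_mx0 u : rho 0 u = 0.
Proof.
have := rep_mxL 1 0 0 u; rewrite !scale1r addr0 => /eqP.
by rewrite -subr_eq subrr => /eqP.
Qed.

Lemma rep_mxD x y u : rho (x + y) u = rho x u + rho y u.
Proof. by have := rep_mxL 1 x y u; rewrite !scale1r. Qed.

Lemma rep_mxZ c x u : rho (c *: x) u = c *: rho x u.
Proof. by have := rep_mxL c x 0 u; rewrite rep_mx0 !addr0. Qed.

Lemma rep_mxN x u : rho (- x) u = - rho x u.
Proof. by rewrite -[- x]scaleN1r rep_mxZ scaleN1r. Qed.

Lemma rep_mx_sum I (r : seq I) (P : pred I) (F : I -> M) u :
  rho (\sum_(i <- r | P i) F i) u = \sum_(i <- r | P i) rho (F i) u.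
Proof.
apply: (big_rec2 (fun a b => rho a u = b)) => [|i a b _ <-]; first exact: rep_mx0.
by rewrite rep_mxD.
Qed.

Lemma rep_comm x y u : rho x (rho y u) = rho y (rho x u) + rho (bracket x y) u.
Proof. by case: rhoP => _ _ ->; rewrite addrC subrK. Qed.

End OneRep.

(** Membership in the Borel subalgebra of gl_(n+1), a complement of n^-; [low] projects onto n^-
    along it. *)
Definition upper x := forall i j : 'I_n.+1, (j < i)%N -> x i j = 0.

Definition low x : M := \matrix_(i, j) (x i j *+ (j < i)%N).

Lemma low_nminus x : nminus (low x).
Proof. by move=> i j le_ij; rewrite mxE ltnNge le_ij mulr0n. Qed.

Lemma sub_low_upper x : upper (x - low x).
Proof. by move=> i j lt_ji; rewrite !mxE lt_ji mulr1n subrr. Qed.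

Lemma low_id x : nminus x -> low x = x.
Proof.
move=> xP; apply/matrixP=> i j; rewrite mxE; case: ltnP => [_|/xP ->].
  by rewrite mulr1n.
by rewrite mul0rn.
Qed.

Lemma low_upper x : upper x -> low x = 0.
Proof.
move=> xP; apply/matrixP=> i j; rewrite !mxE; case: ltnP => [/xP ->|_].
  by rewrite mul0rn.
by rewrite mulr0n.
Qed.

Lemma bracket_nminus x y : nminus x -> nminus y -> nminus (bracket x y).
Proof.
have nmul (a b : M) : nminus a -> nminus b -> nminus (a *m b).
  move=> aP bP i j le_ij; rewrite mxE big1 // => k _.
  have [lt_ki|/aP ->] := ltnP k i; last by rewrite mul0r.
  by rewrite (bP k j) ?mulr0 // (leq_trans (ltnW lt_ki)).
move=> xP yP i j le_ij; have := nmul x y xP yP i j le_ij; have := nmul y x yP xP i j le_ij.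
by rewrite /bracket !mxE => -> ->; rewrite subrr.
Qed.

(** * The PBW filtration and its compatibility with the action *)

Section Filtration.
Variables (V : lmodType C) (rho : M -> V -> V).
Hypothesis rhoP : gl_rep rho.
Variable v : V.

(* The PBW filtration of the cyclic module generated by v. *)
Inductive filt : nat -> V -> Prop :=
| filt_zero d : filt d 0
| filt_gen d : filt d v
| filt_lin d c u w : filt d u -> filt d w -> filt d (c *: u + w)
| filt_low d x u : nminus x -> filt d u -> filt d.+1 (rho x u)
| filt_succ d u : filt d u -> filt d.+1 u.

Lemma filtD d u w : filt d u -> filt d w -> filt d (u + w).
Proof. by move=> hu hw; rewrite -[u]scale1r; apply: filt_lin. Qed.

Lemma filtZ d c u : filt d u -> filt d (c *: u).
Proof. by move=> hu; rewrite -[_ *: _]addr0; apply: filt_lin => //; apply: filt_zero. Qed.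

Lemma filtN d u : filt d u -> filt d (- u).
Proof. by move=> hu; rewrite -scaleN1r; apply: filtZ. Qed.

Lemma filtB d u w : filt d u -> filt d w -> filt d (u - w).
Proof. by move=> hu hw; apply: filtD => //; apply: filtN. Qed.

Lemma filt_sum d I (r : seq I) (P : pred I) F :
  (forall i, P i -> filt d (F i)) -> filt d (\sum_(i <- r | P i) F i).
Proof.
by move=> h; apply: big_ind => //; [apply: filt_zero|apply: filtD].
Qed.

Lemma filt_leq d d' u : (d <= d')%N -> filt d u -> filt d' u.
Proof.
move=> /subnKC <- hu; elim: (d' - d)%N => [|k IH]; first by rewrite addn0.
by rewrite addnS; apply: filt_succ.
Qed.

Lemma filtZr d c u : c != 0 -> filt d (c *: u) -> filt d u.
Proof. by move=> c0 /(filtZ c^-1); rewrite scalerA mulVf // scale1r. Qed.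

Hypothesis hwv : forall x, upper x -> exists c, rho x v = c *: v.

(** Induction along the filtration through x y u = y x u + [x, y] u: the Borel part of [x, y] falls
    under the induction hypothesis, and its part in n^- adds one letter to u, which the level of y u
    allows. *)
Lemma filt_upper d x u : upper x -> filt d u -> filt d (rho x u).
Proof.
move=> xP hu; elim: hu x xP => {d u} [d|d|d c u w _ IHu _ IHw|d y u yP hu IH|d u _ IH] x xP.
- by rewrite rep0 //; apply: filt_zero.
- by have [c ->] := hwv xP; apply/filtZ/filt_gen.
- by rewrite repL //; apply: filt_lin; [apply: IHu|apply: IHw].
- rewrite rep_comm //; apply: filtD; first by apply: filt_low => //; apply: IH.
  rewrite -(subrK (low (bracket x y)) (bracket x y)) rep_mxD //.
  apply: filtD; first by apply: filt_succ; apply: IH; apply: sub_low_upper.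
  exact/filt_low/hu/low_nminus.
- exact/filt_succ/IH.
Qed.

Lemma filt_rho d x u : filt d u -> filt d.+1 (rho x u).
Proof.
move=> hu; rewrite -(subrK (low x) x) rep_mxD //; apply: filtD.
  exact/filt_succ/filt_upper/hu/sub_low_upper.
exact/filt_low/hu/low_nminus.
Qed.

Lemma rho_low d x u : filt d u -> filt d (rho x u - rho (low x) u).
Proof.
move=> hu; rewrite -{1}(subrK (low x) x) rep_mxD // addrK.
exact/filt_upper/hu/sub_low_upper.
Qed.

(** The letters are labels in an arbitrary type [K], so that equal root vectors at different
    positions stay distinguishable when a derivation changes one of them. *)
Definition word (K : Type) (g : K -> M) (r : seq K) : V :=
  foldr (fun k u => rho (g k) u) v r.

Lemma word_filt K (g : K -> M) r : filt (size r) (word g r).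
Proof. by elim: r => [|k r IH] /=; [apply: filt_gen|apply: filt_rho]. Qed.

Lemma filt_word_cat K (g : K -> M) r d u : filt d u ->
  filt (size r + d) (foldr (fun k => rho (g k)) u r).
Proof. by move=> hu; elim: r => [|k r IH] //=; apply: filt_rho. Qed.

Lemma eq_word (K : eqType) (g g' : K -> M) r :
  {in r, g =1 g'} -> word g r = word g' r.
Proof.
elim: r => [|k r IH] //= e; rewrite e ?mem_head // IH // => l lr.
by apply: e; rewrite inE lr orbT.
Qed.

Lemma word_map K L (h : L -> K) (g : K -> M) r : word g (map h r) = word (g \o h) r.
Proof. by rewrite /word foldr_map. Qed.

(** Exchanging two adjacent letters of n^- produces a commutator, again a single letter of n^-,
    hence a word one letter shorter. *)
Lemma word_perm (K : eqType) (g : K -> M) r r' : (forall k, nminus (g k)) ->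
  perm_eq r r' -> filt (size r).-1 (word g r - word g r').
Proof.
move=> gP; elim: r r' => [|k r IH] r'.
  by move=> /perm_size /esym /size0nil ->; rewrite subrr; apply: filt_zero.
move=> e; have kr' : k \in r' by rewrite -(perm_mem e) mem_head.
case/splitPr: kr' e => r1 r2 e.
have {}e : perm_eq r (r1 ++ r2).
  by rewrite -(perm_cons k) (perm_trans e) // perm_catC /= perm_cons perm_catC.
have sz : size r = size (r1 ++ r2) by rewrite (perm_size e).
(* Two stages: the tail is permuted behind a leading [k], then [k] travels through [r1] letter by
   letter. *)
have -> : word g (k :: r) - word g (r1 ++ k :: r2) =
  rho (g k) (word g r - word g (r1 ++ r2)) +
  (word g (k :: r1 ++ r2) - word g (r1 ++ k :: r2)).
  by rewrite repB //= addrA subrK.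
apply: filtD => /=.
  case: r IH sz e => [|k' r] IH sz e /=.
    case: (r1 ++ r2) sz => // _.
    by rewrite subrr rep0 //; apply: filt_zero.
  exact/filt_rho/IH.
have {IH e} : (size r1 + size r2 = size r)%N by rewrite sz size_cat.
elim: r1 {r sz} (size r) => [|l r1 IH] d /= e; first by rewrite subrr; apply: filt_zero.
rewrite rep_comm // addrAC -repB //; case: d e => // d [e].
apply: filtD; first by apply: filt_rho; apply: (IH d).
apply: filt_low; first exact: bracket_nminus.
by rewrite -e -size_cat; apply: word_filt.
Qed.

(* Modulo shorter words, e acts as the derivation of the symmetric algebra of
   n^- = sl / b induced by the adjoint action. *)
Lemma word_der (K : eqType) (g : K -> M) r e : uniq r -> upper e -> rho e v = 0 ->
  filt (size r).-1 (rho e (word g r) -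
    \sum_(k <- r) word (fun l => if l == k then low (bracket e (g k)) else g l) r).
Proof.
move=> + eP ev; elim: r => [|k r IH] /=.
  by move=> _; rewrite ev big_nil subr0; apply/filt_zero.
move=> /andP[kr ur]; rewrite big_cons eqxx.
rewrite (@eq_word _ (fun l => _) g); last first.
  by move=> l lr /=; case: eqP => // ek; rewrite -ek lr in kr.
rewrite rep_comm // opprD [X in _ + X]addrC addrACA.
apply: filtD; last exact/rho_low/word_filt.
rewrite (eq_big_seq (fun l => rho (g k) (word (fun l' =>
  if l' == l then low (bracket e (g l)) else g l') r))); last first.
  by move=> l lr; case: eqP => // ek; rewrite ek lr in kr.
rewrite -rep_sum // -repB //.
case: r {kr} IH ur => [|k' r] IH ur.
  by rewrite /= big_nil ev subr0 rep0 //; apply: filt_zero.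
by apply: filt_rho; apply: IH.
Qed.

End Filtration.
End GLRep.

(** * Polarization of the power of a root vector by n^+ *)

Section Polarization.
Variables (C : numFieldType) (n : nat) (V : lmodType C).
Local Notation M := 'M[C]_n.+1.
Local Notation ix := 'I_n.+1.
Variable rho : M -> V -> V.
Hypothesis rhoP : gl_rep rho.
Variable v : V.
Hypothesis hwv : forall x, upper x -> exists c, rho x v = c *: v.
Hypothesis hw0 : forall x, nplus x -> rho x v = 0.

(** The value 0 for y <= x is the class of the matrix unit modulo the Borel subalgebra; sums may
    thus run over all permutations. *)
Definition lower_unit (x y : ix) : M := if (x < y)%N then delta_mx y x else 0.

Lemma lower_unit0 (x y : ix) : (y <= x)%N -> lower_unit x y = 0.
Proof. by rewrite /lower_unit ltnNge => ->. Qed.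

Lemma low_delta (x y : ix) : low (delta_mx y x : M) = lower_unit x y.
Proof.
rewrite /lower_unit; case: ltnP => [lt_xy|le_yx]; [apply: low_id|apply: low_upper].
  move=> i j le_ij; rewrite mxE; case: eqP => //= ei; case: eqP => // ej.
  by move: lt_xy; rewrite -ei -ej ltnNge le_ij.
move=> i j lt_ji; rewrite mxE; case: eqP => //= ei; case: eqP => // ej.
by move: le_yx; rewrite -ei -ej leqNgt lt_ji.
Qed.

Lemma lower_unit_nminus (x y : ix) : nminus (lower_unit x y).
Proof. by rewrite -low_delta; apply: low_nminus. Qed.

Lemma low0 : low (0 : M) = 0.
Proof. by apply/matrixP=> i j; rewrite !mxE mul0rn. Qed.

Lemma lowB (x y : M) : low (x - y) = low x - low y.
Proof. by apply/matrixP=> i j; rewrite !mxE mulrnBl. Qed.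

Lemma lowMn (x : M) k : low (x *+ k) = low x *+ k.
Proof. by elim: k => [|k IH]; [rewrite low0|rewrite !mulrS -IH; apply/matrixP=> i j; rewrite !mxE mulrnDl]. Qed.

Lemma bracket_delta (a b c d : ix) :
  bracket (delta_mx a b : M) (delta_mx c d) =
  delta_mx a d *+ (b == c) - delta_mx c b *+ (d == a).
Proof. by rewrite /bracket !mul_delta_mx_cond. Qed.

Lemma bracket_mx0 (x : M) : bracket x 0 = 0.
Proof. by rewrite /bracket mulmx0 mul0mx subrr. Qed.

(** The second term of the commutator lies in row y' and column b, hence in the Borel subalgebra as
    y' <= b. What survives replaces the end b of a letter by y. *)
Lemma low_bracket_col (y b x' y' : ix) : (y < b)%N -> (y' <= b)%N ->
  low (bracket (delta_mx y b) (lower_unit x' y')) = lower_unit x' y *+ (y' == b).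
Proof.
move=> yb y'b; have [lt|le] := ltnP x' y'.
  rewrite /lower_unit lt bracket_delta lowB !lowMn !low_delta.
  by rewrite (@lower_unit0 b y') // mul0rn subr0 eq_sym.
rewrite (lower_unit0 le) bracket_mx0 low0; case: eqP => [e|]; last by rewrite mulr0n.
by rewrite lower_unit0 // (leq_trans (ltnW yb)) // -e.
Qed.

(** Here the term in row a and column x' is upper triangular as a <= x'; what survives replaces the
    start a of a letter by x, with a sign. *)
Lemma low_bracket_row (a x x' y' : ix) : (a < x)%N -> (a <= x')%N ->
  low (bracket (delta_mx a x) (lower_unit x' y')) = - lower_unit x y' *+ (x' == a).
Proof.
move=> ax ax'; have [lt|le] := ltnP x' y'.
  rewrite /lower_unit lt bracket_delta lowB !lowMn !low_delta.
  by rewrite (@lower_unit0 x' a) // mul0rn sub0r mulNrn.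
rewrite (lower_unit0 le) bracket_mx0 low0; case: eqP => [e|]; last by rewrite mulr0n.
by rewrite lower_unit0 ?oppr0 ?mul0rn // (leq_trans le) // e ltnW.
Qed.

Lemma delta_upper (a b : ix) : (a <= b)%N -> upper (delta_mx a b : M).
Proof.
move=> ab i j lt_ji; rewrite mxE; case: eqP => //= ei; case: eqP => // ej.
by move: ab; rewrite -ei -ej leqNgt lt_ji.
Qed.

Lemma delta_nplus (a b : ix) : (a < b)%N -> nplus (delta_mx a b : M).
Proof.
move=> ab i j lt_ji; rewrite mxE; case: eqP => //= ei; case: eqP => // ej.
by move: ab; rewrite -ei -ej ltnNge lt_ji.
Qed.

Lemma word_zero (K : eqType) (g : K -> M) r k :
  k \in r -> g k = 0 -> word rho v g r = 0.
Proof.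
move=> + gk; elim: r => [|l r IH] //=; rewrite inE => /orP[/eqP <-|/IH ->].
  by rewrite gk rep_mx0.
by rewrite rep0.
Qed.

Lemma word_opp (K : eqType) (g g' : K -> M) r k : k \in r -> uniq r ->
  g' k = - g k -> {in predC1 k, g' =1 g} -> word rho v g' r = - word rho v g r.
Proof.
move=> + + ek eg; elim: r => [|l r IH] //=; rewrite inE => + /andP[lr ur].
have [ekl _|ne /=] := eqVneq k l.
  rewrite -ekl ek rep_mxN //; congr (- rho _ _); apply: eq_word => l' l'r.
  by apply: eg; rewrite inE; apply: contraNneq lr; rewrite -ekl => <-.
by move=> kr; rewrite IH // repN // eg // inE eq_sym.
Qed.

Variable N : nat.
Implicit Types X Y : 'I_N -> ix.

(* The image in the symmetric algebra of the polarized power: it is spread from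
   the power of a single root by the operators of n^+. *)
Definition polar_sum X Y : V :=
  \sum_(s : 'S_N) word rho v (fun k => lower_unit (X k) (Y (s k))) (enum 'I_N).

Definition upd X k z : 'I_N -> ix := fun l => if l == k then z else X l.

Lemma eq_polar_sum X X' Y Y' : X =1 X' -> Y =1 Y' -> polar_sum X Y = polar_sum X' Y'.
Proof.
move=> eX eY; apply: eq_bigr => s _; apply: eq_word => k _; congr lower_unit => //.
Qed.

(** By [word_der] the operator replaces one end b by y at a time; reindexing by [s] turns positions
    of letters into positions of [Y]. *)
Lemma polar_sum_col X Y (y b : ix) : (y < b)%N -> (forall k, Y k <= b)%N ->
  filt rho v N.-1 (rho (delta_mx y b) (polar_sum X Y) -
    \sum_(l | Y l == b) polar_sum X (upd Y l y)).
Proof.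
move=> yb Yb; rewrite rep_sum // exchange_big -sumrB /=; apply: filt_sum => s _.
have := word_der rhoP hwv (fun k => lower_unit (X k) (Y (s k))) (enum_uniq 'I_N)
  (delta_upper (ltnW yb)) (hw0 (delta_nplus yb)).
rewrite size_enum_ord; congr (filt _ _ _ (_ - _)).
rewrite big_enum /= [RHS](reindex_inj (@perm_inj _ s)) /= [RHS]big_mkcond /=.
apply: eq_bigr => k _; case: eqP => [e|ne].
  apply: eq_word => l _; case: eqVneq => [->|nlk].
    by rewrite low_bracket_col // e eqxx mulr1n /upd eqxx.
  by rewrite /upd (inj_eq perm_inj) (negPf nlk).
apply: (@word_zero _ _ _ k); first by rewrite mem_enum.
by rewrite eqxx low_bracket_col //; case: eqP => // _; rewrite mulr0n.
Qed.

Lemma polar_sum_row X Y (a x : ix) : (a < x)%N -> (forall k, a <= X k)%N ->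
  filt rho v N.-1 (rho (delta_mx a x) (polar_sum X Y) +
    \sum_(l | X l == a) polar_sum (upd X l x) Y).
Proof.
move=> ax aX; rewrite rep_sum // exchange_big -big_split /=; apply: filt_sum => s _.
have := word_der rhoP hwv (fun k => lower_unit (X k) (Y (s k))) (enum_uniq 'I_N)
  (delta_upper (ltnW ax)) (hw0 (delta_nplus ax)).
rewrite size_enum_ord; congr (filt _ _ _ (_ + _)); rewrite -sumrN.
rewrite big_enum /= [RHS]big_mkcond /=.
apply: eq_bigr => k _; case: eqP => [e|ne].
  rewrite -[RHS]opprK; congr (- _); apply: (@word_opp _ _ _ _ k); rewrite ?mem_enum ?enum_uniq //.
    by rewrite eqxx low_bracket_row // e eqxx mulr1n /upd eqxx.
  by move=> l; rewrite inE /upd => /negPf ->.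
apply/eqP; rewrite oppr_eq0; apply/eqP.
apply: (@word_zero _ _ _ k); first by rewrite mem_enum.
by rewrite eqxx low_bracket_row //; case: eqP => // _; rewrite mulr0n.
Qed.

Lemma polar_sum_permY X Y (t : 'S_N) : polar_sum X (Y \o t) = polar_sum X Y.
Proof.
rewrite /polar_sum [RHS](reindex_inj (mulIg t)) /=; apply: eq_bigr => s _.
by apply: eq_word => k _; rewrite permM.
Qed.

(** A permutation of [X], unlike one of [Y], also reorders the letters, so equality holds modulo
    shorter words. *)
Lemma polar_sum_permX X Y (t : 'S_N) :
  filt rho v N.-1 (polar_sum (X \o t) Y - polar_sum X Y).
Proof.
rewrite /polar_sum [X in _ - X](reindex_inj (mulgI t^-1%g)) /= -sumrB.
apply: filt_sum => s _.
have -> : word rho v (fun k => lower_unit (X (t k)) (Y (s k))) (enum 'I_N) =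
  word rho v (fun k => lower_unit (X k) (Y ((t^-1 * s)%g k))) (map t (enum 'I_N)).
  by rewrite [RHS]word_map; apply: eq_word => k _ /=; rewrite permM permK.
rewrite -[N in N.-1]size_enum_ord -(size_map t); apply: word_perm => //.
  by move=> k; apply: lower_unit_nminus.
apply: uniq_perm; rewrite ?(map_inj_uniq (@perm_inj _ t)) ?enum_uniq // => k.
by rewrite mem_enum -(permKV t k) mem_map ?mem_enum //; apply: perm_inj.
Qed.

(** Undoing an update at another position [l] gives [Y] up to a transposition, so all terms of the
    derivation agree up to a permutation. *)
Lemma upd_tperm Y (l l0 : 'I_N) (y b : ix) : Y l0 = y ->
  upd Y l0 b l = b -> upd (upd Y l0 b) l y =1 Y \o tperm l l0.
Proof.
move=> Yl0 e k; rewrite /upd /=; case: tpermP => [->|->|/eqP/negPf -> /eqP/negPf -> //].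
  by rewrite eqxx.
rewrite eqxx; case: eqP => [<-|ne]; first by rewrite -Yl0.
by move: e; rewrite /upd; case: eqP => // e _; rewrite e in ne.
Qed.

Lemma natr_sum_const (P : pred 'I_N) (u : V) :
  \sum_(l | P l) u = #|P|%:R *: u.
Proof. by rewrite sumr_const scaler_nat. Qed.

(** The prescribed values are reached from the constant ones one entry at a time, first in [Y], then
    in [X]: the operator of n^+ moving b to [Y k0], applied while that entry still equals b, gives
    as many copies of the wanted sum as there are entries b. Characteristic zero allows division by
    this number. *)
Lemma filt_polar_sum (a b : ix) X Y : (a < b)%N ->
  (forall k, a <= X k)%N -> (forall k, Y k <= b)%N ->
  filt rho v N.-1 (polar_sum (fun _ => a) (fun _ => b)) ->
  filt rho v N.-1 (polar_sum X Y).
Proof.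
move=> ab aX Yb Z0.
have {Z0 Yb} ZY : filt rho v N.-1 (polar_sum (fun _ => a) Y).
  have [d] := ubnP #|[pred k | Y k != b]|; elim: d Y Yb => // d IH Y Yb le_d.
  have [eY|[k0 Yk0]] : Y =1 (fun _ => b) \/ exists k0, Y k0 != b.
    have [/existsP[k0 ?]|/existsPn h] := boolP [exists k, Y k != b]; first by right; exists k0.
    by left=> k; have := h k; rewrite negbK => /eqP.
    by rewrite (@eq_polar_sum _ (fun _ => a) _ (fun _ => b)).
  pose Y' := upd Y k0 b.
  have Y'b k : (Y' k <= b)%N by rewrite /Y' /upd; case: eqP.
  have hY' : filt rho v N.-1 (polar_sum (fun _ => a) Y').
    apply: IH => //; move: le_d; rewrite ltnS; apply: leq_trans; apply: proper_card.
    apply/properP; split; last by exists k0; rewrite !inE // /Y' /upd !eqxx.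
    by apply/fintype.subsetP=> k; rewrite !inE /Y' /upd; have [->|] := eqVneq k k0; rewrite ?eqxx.
  have yb : (Y k0 < b)%N by rewrite ltn_neqAle Yk0 Yb.
  have up := delta_upper (ltnW yb).
  have := filtB (filt_upper rhoP hwv up hY') (polar_sum_col (fun _ => a) yb Y'b).
  rewrite opprB addrC subrK.
  rewrite (eq_bigr (fun _ => polar_sum (fun _ => a) Y)) => [|l /eqP e].
    rewrite natr_sum_const; apply: filtZr; rewrite pnatr_eq0 -lt0n.
    by apply/card_gt0P; exists k0; rewrite ?inE unfold_in /Y' /upd !eqxx.
  rewrite -(polar_sum_permY _ Y (tperm l k0)); apply: eq_polar_sum => //.
  exact: upd_tperm.
have [d] := ubnP #|[pred k | X k != a]|; elim: d X aX => // d IH X aX le_d.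
have [eX|[k0 Xk0]] : X =1 (fun _ => a) \/ exists k0, X k0 != a.
  have [/existsP[k0 ?]|/existsPn h] := boolP [exists k, X k != a]; first by right; exists k0.
  by left=> k; have := h k; rewrite negbK => /eqP.
  by rewrite (@eq_polar_sum _ (fun _ => a) _ Y).
pose X' := upd X k0 a.
have X'a k : (a <= X' k)%N by rewrite /X' /upd; case: eqP.
have hX' : filt rho v N.-1 (polar_sum X' Y).
  apply: IH => //; move: le_d; rewrite ltnS; apply: leq_trans; apply: proper_card.
  apply/properP; split; last by exists k0; rewrite !inE // /X' /upd !eqxx.
  by apply/fintype.subsetP=> k; rewrite !inE /X' /upd; have [->|] := eqVneq k k0; rewrite ?eqxx.
have ax : (a < X k0)%N by rewrite ltn_neqAle eq_sym Xk0 aX.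
have up := delta_upper (ltnW ax).
have := filtB (polar_sum_row Y ax X'a) (filt_upper rhoP hwv up hX').
rewrite addrAC subrr add0r.
have h : filt rho v N.-1 (\sum_(l | X' l == a) (polar_sum (upd X' l (X k0)) Y - polar_sum X Y)).
  apply: filt_sum => l /eqP e.
  rewrite (@eq_polar_sum _ (X \o tperm l k0) _ Y) //; first exact: polar_sum_permX.
  exact: upd_tperm.
move=> h'; have := filtB h' h; rewrite -sumrB.
rewrite (eq_bigr (fun _ => polar_sum X Y)) => [|l _]; last by rewrite opprB addrC subrK.
rewrite natr_sum_const; apply: filtZr; rewrite pnatr_eq0 -lt0n.
by apply/card_gt0P; exists k0; rewrite ?inE unfold_in /X' /upd !eqxx.
Qed.

End Polarization.

(** * Spanning *)

Section Rearrangement.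
Local Open Scope nat_scope.
Implicit Types (r : seq (nat * nat)) (z : nat * nat).

Definition quadrant a b r := count (fun z => (a <= z.1) && (b <= z.2)) r.

(** A product counts the lattice points of a rectangle; sums of products thereby become sums of
    quadrant counts. *)
Lemma mul_quadrant K z : z.1 <= K -> z.2 <= K ->
  z.1 * z.2 = \sum_(a < K) \sum_(b < K) ((a < z.1) && (b < z.2)).
Proof.
have cnt m : m <= K -> \sum_(a < K) (a < m) = m.
  move=> le_mK; rewrite -[LHS]big_mkcond /= -(big_ord_widen K (fun _ => 1) le_mK).
  by rewrite sum_nat_const card_ord muln1.
move=> /cnt {1}<- /cnt {1}<-; rewrite big_distrl; apply: eq_bigr => a _ /=.
by rewrite big_distrr; apply: eq_bigr => b _ /=; rewrite mulnb.
Qed.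

Lemma sum_quadrant K r : {in r, forall z, (z.1 <= K) && (z.2 <= K)} ->
  \sum_(z <- r) z.1 * z.2 = \sum_(a < K) \sum_(b < K) quadrant a.+1 b.+1 r.
Proof.
move=> rK; rewrite (eq_big_seq _ (fun z zr => mul_quadrant (proj1 (andP (rK z zr))) (proj2 (andP (rK z zr))))).
rewrite exchange_big; apply: eq_bigr => a _ /=.
rewrite exchange_big; apply: eq_bigr => b _ /=.
by rewrite /quadrant -sum1_count [RHS]big_mkcond.
Qed.

(** Inclusion-exclusion over four neighbouring quadrants, arranged so that no subtraction occurs. *)
Lemma count_quadrant r z :
  count_mem z r + quadrant z.1.+1 z.2 r + quadrant z.1 z.2.+1 r =
  quadrant z.1 z.2 r + quadrant z.1.+1 z.2.+1 r.
Proof.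
have pt (t : nat * nat) : (t == z) + (z.1 < t.1) && (z.2 <= t.2) + (z.1 <= t.1) && (z.2 < t.2) =
    (z.1 <= t.1) && (z.2 <= t.2) + (z.1 < t.1) && (z.2 < t.2).
  have -> : (t == z) = (t.1 == z.1) && (t.2 == z.2) by case: t z => [? ?] [].
  by case: (ltngtP t.1 z.1); case: (ltngtP t.2 z.2).
rewrite /quadrant; elim: r => //= t r; move: (pt t).
repeat match goal with |- context [count ?p r] => generalize (count p r) end.
repeat match goal with |- context [nat_of_bool ?b] => generalize (nat_of_bool b) end.
lia.
Qed.

Definition grid_comparable z z' := (z.1 <= z'.1) && (z.2 <= z'.2) || (z'.1 <= z.1) && (z'.2 <= z.2).

(** In a chain, a point within the first bound but outside the second forces all points within the
    second bound to be within the first; without such a point the first bound implies the second. So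
    the quadrant count of [r] is one of the two marginal counts, and both of these bound the
    quadrant count of [r']. *)
Lemma leq_quadrant r r' :
  (forall a, count (fun z => a <= z.1) r' = count (fun z => a <= z.1) r) ->
  (forall b, count (fun z => b <= z.2) r' = count (fun z => b <= z.2) r) ->
  {in r &, forall z z', grid_comparable z z'} ->
  forall a b, quadrant a b r' <= quadrant a b r.
Proof.
move=> r1 r2 cr a b.
have [/hasP[z zr /andP[za zb]]|/hasPn h] := boolP (has (fun z => (a <= z.1) && (z.2 < b)) r).
  have -> : quadrant a b r = count (fun z => b <= z.2) r.
    apply: eq_in_count => t tr; have := cr _ _ zr tr; rewrite /grid_comparable; lia.
  by rewrite -r2; apply: sub_count => t /andP[].
have -> : quadrant a b r = count (fun z => a <= z.1) r.
  by apply: eq_in_count => t tr; have := h _ tr; lia.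
by rewrite -r1; apply: sub_count => t /andP[].
Qed.

(* A chain maximizes all the quadrant counts simultaneously, and the quadrant
   counts determine the multiset. *)
Lemma rearrangement r r' :
  (forall a, count (fun z => a <= z.1) r' = count (fun z => a <= z.1) r) ->
  (forall b, count (fun z => b <= z.2) r' = count (fun z => b <= z.2) r) ->
  {in r &, forall z z', grid_comparable z z'} ->
  \sum_(z <- r') z.1 * z.2 <= \sum_(z <- r) z.1 * z.2 ?= iff perm_eq r' r.
Proof.
move=> r1 r2 cr; have leT := leq_quadrant r1 r2 cr.
pose K := \max_(z <- r ++ r') maxn z.1 z.2.
have bK z : z \in r ++ r' -> (z.1 <= K) && (z.2 <= K).
  by move=> zr; rewrite -geq_max /K; apply: leq_bigmax_seq.
have rK : {in r, forall z, (z.1 <= K) && (z.2 <= K)}.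
  by move=> z zr; apply: bK; rewrite mem_cat zr.
have r'K : {in r', forall z, (z.1 <= K) && (z.2 <= K)}.
  by move=> z zr; apply: bK; rewrite mem_cat zr orbT.
split; first by rewrite (sum_quadrant rK) (sum_quadrant r'K); do 2!apply: leq_sum => ? _.
apply/idP/idP; last by move=> p; apply/eqP/(perm_big _ p).
move=> /eqP e.
have eT a b : a < K -> b < K -> quadrant a.+1 b.+1 r' = quadrant a.+1 b.+1 r.
  move: e; rewrite (sum_quadrant rK) (sum_quadrant r'K) => e aK bK'.
  apply/eqP; rewrite eqn_leq leT /= leqNgt; apply/negP => lt.
  move/eqP: e; apply/negP; rewrite neq_ltn; apply/orP; left.
  rewrite (bigD1 (Ordinal aK)) //= [X in _ < X](bigD1 (Ordinal aK)) //=.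
  rewrite -addSn leq_add //; last by do 2!apply: leq_sum => ? _.
  rewrite (bigD1 (Ordinal bK')) //= [X in _ < X](bigD1 (Ordinal bK')) //=.
  by rewrite -addSn leq_add //; apply: leq_sum => ? _.
have eQ a b : quadrant a b r' = quadrant a b r.
  case: a b => [|a] [|b]; rewrite /quadrant.
  - by have := r1 0; rewrite /=.
  - exact: r2.
  - have eq0 : (fun z => (a < z.1) && (0 <= z.2)) =1 (fun z => a < z.1) by move=> z; rewrite andbT.
    by rewrite !(eq_count eq0).
  - have [aK|aK] := ltnP a K; last first.
      rewrite !(@eq_in_count _ _ pred0) ?count_pred0 // => z.
        by move=> /rK /=; lia.
      by move=> /r'K /=; lia.
    have [bK'|bK'] := ltnP b K; last first.
      rewrite !(@eq_in_count _ _ pred0) ?count_pred0 // => z.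
        by move=> /rK /=; lia.
      by move=> /r'K /=; lia.
    exact: eT.
apply/allP => z _ /=; apply/eqP.
have := count_quadrant r' z; rewrite !eQ -(count_quadrant r) => /eqP.
by rewrite !eqn_add2r => /eqP.
Qed.

End Rearrangement.

(** * Positive roots, their order, and Dyck paths as chains *)

Section PosRoots.
Variable n : nat.
Implicit Types a b : posroot n.

Definition mkroot (p q : 'I_n) (pq : (p <= q)%N) : posroot n :=
  exist (fun u : 'I_n * 'I_n => (u.1 <= u.2)%N) (p, q) pq.

(** In standard coordinates alpha_(p,q) is e_rx - e_ry, so its negative root vector sits in row [ry]
    and column [rx]. *)
Definition rx a : 'I_n.+1 := lo (val a).1.
Definition ry a : 'I_n.+1 := hi (val a).2.

Lemma ryE a : ry a = (val a).2.+1 :> nat.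
Proof. by rewrite /= /bump leq0n. Qed.

Lemma rx_lt_ry a : (rx a < ry a)%N.
Proof. by rewrite ryE ltnS; case: a. Qed.

Lemma rxy_inj a b : rx a = rx b :> nat -> ry a = ry b :> nat -> a = b.
Proof.
case: a b => [[p q] pq] [[p' q'] pq'] /= e1; rewrite !/bump /= !add1n => -[e2].
by apply/val_inj; congr (_, _); apply/val_inj.
Qed.

Lemma posroot_of (x y : 'I_n.+1) : (x < y)%N -> exists a, rx a = x /\ ry a = y.
Proof.
move=> xy; have xn : (x < n)%N by apply: leq_trans xy _; rewrite -ltnS.
have y0 : (0 < y)%N by apply: leq_ltn_trans xy.
have yn : (y.-1 < n)%N by rewrite -ltnS prednK.
have pq : (Ordinal xn <= Ordinal yn)%N by rewrite /= -ltnS prednK.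
by exists (mkroot pq); split; apply/val_inj => //=; rewrite /bump add1n prednK.
Qed.

(** Dyck paths are the saturated chains of this order between simple roots. *)
Definition root_lt a b :=
  [&& ((val a).1 <= (val b).1)%N, ((val a).2 <= (val b).2)%N & (a != b)].

Lemma root_lt_coord a b : root_lt a b -> (rx a <= rx b)%N && (ry a <= ry b)%N.
Proof. by case/and3P=> h1 h2 _; rewrite h1 !ryE ltnS. Qed.

Lemma root_lt_trans : transitive root_lt.
Proof.
move=> b a c /and3P[ab1 ab2 nab] /and3P[bc1 bc2 nbc]; apply/and3P; split.
- exact: leq_trans bc1.
- exact: leq_trans bc2.
apply: contraNneq nab => eac; rewrite -eac in bc1 bc2.
apply/eqP/rxy_inj; first by apply/eqP; rewrite /= eqn_leq ab1.
by rewrite !ryE; congr _.+1; apply/eqP; rewrite eqn_leq ab2.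
Qed.

Lemma root_lt_irr : irreflexive root_lt.
Proof. by move=> a; rewrite /root_lt eqxx !andbF. Qed.

Lemma dyck_step_lt a b : dyck_step a b -> root_lt a b.
Proof.
rewrite /dyck_step /root_lt; case: a b => [[p q] /= pq] [[p' q'] /= pq'].
case/orP=> /andP[/eqP e1 /eqP e2].
  subst p'; rewrite e2 leqnn leqnSn /=; apply/eqP => -[e3].
  by move: e2; rewrite e3 => /n_Sn.
subst q'; rewrite e1 leqnn leqnSn /=; apply/eqP => -[e3].
by move: e1; rewrite e3 => /n_Sn.
Qed.

Lemma dyck_sorted i j p : dyck_path i j p -> sorted root_lt p.
Proof.
by case: p => // b0 p /and4P[_ _ h _]; apply: (sub_path dyck_step_lt h).
Qed.

Lemma sorted_root_comparable p a b : sorted root_lt p -> a \in p -> b \in p ->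
  [|| a == b, root_lt a b | root_lt b a].
Proof.
move=> sp ap bp.
have lt c d : c \in p -> d \in p -> (index c p < index d p)%N -> root_lt c d.
  move=> cp dp lt; have /(pairwiseP c) h : pairwise root_lt p.
    by rewrite -(sorted_pairwise root_lt_trans).
  have := h (index c p) (index d p); rewrite !inE !index_mem !nth_index //.
  by move=> /(_ cp dp lt).
have [//|ne] /= := eqVneq a b.
case: (ltngtP (index a p) (index b p)) => [/lt ->//|/lt -> //|e]; first by rewrite orbT.
by move: ne; rewrite -(nth_index a ap) e nth_index // eqxx.
Qed.

Lemma dyck_bounds i j p a : dyck_path i j p -> a \in p ->
  [&& (i <= (val a).1)%N & ((val a).2 <= j)%N].
Proof.
move=> dp ap; have := dyck_sorted dp; move: dp ap; case: p => // b0 p.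
move=> /and4P[/eqP b0i /eqP bj _ _] ap sp.
have b0p : b0 \in b0 :: p by rewrite mem_head.
have lp : last b0 p \in b0 :: p by rewrite mem_last.
have root_lt_le c d : root_lt c d -> ((val c).1 <= (val d).1)%N && ((val c).2 <= (val d).2)%N.
  by case/and3P=> -> ->.
apply/andP; split.
  have [<-|] := eqVneq b0 a; first by rewrite b0i.
  move: ap; rewrite inE eq_sym => /predU1P[->|]; first by rewrite eqxx.
  move: sp; rewrite /= (path_sortedE root_lt_trans) => /andP[/allP h _] /h /root_lt_le.
  by rewrite b0i => /andP[].
have: sorted root_lt (rcons (belast b0 p) (last b0 p)) by rewrite -lastI.
rewrite (sorted_pairwise root_lt_trans) pairwise_rcons => /andP[/allP h _].
move: ap; rewrite lastI mem_rcons inE => /predU1P[->|/h /root_lt_le].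
  by rewrite bj.
by rewrite bj => /andP[].
Qed.

Lemma dyck_leq (i j : 'I_n) p : dyck_path i j p -> (i <= j)%N.
Proof.
move=> dp; have [a ap] : exists a, a \in p.
  by case: p dp => // b p _; exists b; rewrite mem_head.
have /andP[ia aj] := dyck_bounds dp ap.
by apply: leq_trans ia (leq_trans _ aj); case: (a).
Qed.

Lemma sorted_root_uniq p : sorted root_lt p -> uniq p.
Proof. by apply: sorted_uniq; [apply: root_lt_trans|apply: root_lt_irr]. Qed.

Definition multideg (r : seq (posroot n)) : multiexp n := [ffun a => count_mem a r].

Lemma count_mem_sum (T : eqType) (p r : seq T) : uniq p ->
  count (mem p) r = \sum_(b <- p) count_mem b r.
Proof.
move=> up; elim: r => [|a r IH] /=; first by rewrite big1.
rewrite big_split /= -IH; congr (_ + _)%N.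
rewrite -big_mkcond /= sum1_count -(count_uniq_mem _ up).
by apply: eq_count => b; rewrite /= eq_sym.
Qed.

Lemma perm_multideg r r' : perm_eq r r' <-> multideg r = multideg r'.
Proof.
split=> [/seq.permP h|/ffunP h]; first by apply/ffunP => a; rewrite !ffunE.
by apply/allP => a _ /=; have := h a; rewrite !ffunE => ->.
Qed.

End PosRoots.
Arguments rx : simpl never.
Arguments ry : simpl never.

(** * Straightening of words along violated Dyck paths *)

Section Spanning.
Variables (C : numFieldType) (n : nat) (V : lmodType C).
Local Notation M := 'M[C]_n.+1.
Variable rho : M -> V -> V.
Hypothesis rhoP : gl_rep rho.
Variable v : V.
Hypothesis hwv : forall x, upper x -> exists c, rho x v = c *: v.
Hypothesis hw0 : forall x, nplus x -> rho x v = 0.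

Definition root_mx (a : posroot n) : M := delta_mx (ry a) (rx a).

Lemma root_mx_nminus a : nminus (root_mx a).
Proof.
have := lower_unit_nminus C (rx a) (ry a); rewrite /lower_unit rx_lt_ry; exact.
Qed.

Lemma nminus_sum (x : M) : nminus x -> x = \sum_a x (ry a) (rx a) *: root_mx a.
Proof.
move=> xP; apply/matrixP=> i j; rewrite summxE.
have [le_ij|/posroot_of[a [<- <-]]] := leqP i j.
  by rewrite (xP _ _ le_ij) big1 // => a _; rewrite mxE (root_mx_nminus a le_ij) mulr0.
rewrite (bigD1 a) //= big1 ?addr0 => [|b ba]; first by rewrite !mxE !eqxx mulr1.
rewrite !mxE; case: eqP => [/(congr1 val) e1|]; last by rewrite mulr0.
case: eqP => [/(congr1 val) e2|]; last by rewrite mulr0.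
by rewrite (rxy_inj (esym e2) (esym e1)) eqxx in ba.
Qed.

Local Notation wd := (word rho v root_mx).

(** The predicate is generalized before the induction: for an element [rho x u] it is replaced by
    its preimage under [rho x], again stable under linear combinations. *)
Lemma filt_ind_words (B : V -> Prop) d u :
  B 0 -> (forall c u w, B u -> B w -> B (c *: u + w)) ->
  (forall r, (size r <= d)%N -> B (wd r)) -> filt rho v d u -> B u.
Proof.
move=> + + + hu; elim: hu B => {d u}.
- by [].
- by move=> d B _ _ /(_ [::]); apply.
- by move=> d c u w _ IHu _ IHw B B0 BL hB; apply: (BL); [apply: IHu|apply: IHw].
- move=> d x u xP _ IH B B0 BL hB.
  apply: (IH (fun u => B (rho x u))) => [|c u1 w|r sr]; first by rewrite rep0.
    by rewrite repL //; apply: BL.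
  rewrite (nminus_sum xP) rep_mx_sum //; apply: big_ind => //.
    by move=> u1 w hu1 hw1; rewrite -[u1]scale1r; apply: BL.
  move=> a _; rewrite rep_mxZ // -[_ *: _]addr0; apply: BL => //.
  exact: (hB (a :: r)).
- by move=> d u _ IH B B0 BL hB; apply: IH => // r sr; apply: hB; apply: leqW.
Qed.

Variable m : 'I_n -> nat.
Hypothesis powers : forall (a : posroot n) N,
  (\sum_(k < n | ((val a).1 <= k <= (val a).2)%N) m k < N)%N ->
  iter N (rho (root_mx a)) v = 0.

(** [B] stands for the span of the words [w s] with s in S(lambda), abstracted as a predicate stable
    under linear combinations. *)
Variable B : V -> Prop.
Hypothesis B0 : B 0.
Hypothesis BL : forall c u w, B u -> B w -> B (c *: u + w).
Variable w : multiexp n -> seq (posroot n).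
Hypothesis wP : forall s, S_lambda m s -> forall a, count_mem a (w s) = s a.
Hypothesis BS : forall s, S_lambda m s -> B (wd (w s)).

Let BD u1 u2 : B u1 -> B u2 -> B (u1 + u2).
Proof. by move=> h1 h2; rewrite -[u1]scale1r; apply: BL. Qed.
Let BZ c u : B u -> B (c *: u).
Proof. by move=> h; rewrite -[_ *: _]addr0; apply: BL. Qed.
Let BB u1 u2 : B u1 -> B u2 -> B (u1 - u2).
Proof. by move=> h1 h2; rewrite -scaleN1r addrC; apply: BL. Qed.

(** The second component of the termination measure, after the length. *)
Let area (r : seq (posroot n)) := (\sum_(a <- r) rx a * ry a)%N.

Section Straightening.
Variables (r : seq (posroot n)) (i j : 'I_n) (p : seq (posroot n)).
Hypothesis IHd : forall u, filt rho v (size r).-1 u -> B u.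
Hypothesis IHarea : forall r', size r' = size r -> (area r' < area r)%N -> B (wd r').
Hypothesis dp : dyck_path i j p.
Hypothesis viol : (\sum_(k < n | (i <= k <= j)%N) m k < \sum_(b <- p) multideg r b)%N.

Let r1 := [seq a <- r | a \in p].
Let r2 := [seq a <- r | a \notin p].
Let N := size r1.
Let t (k : 'I_N) : posroot n := tnth (in_tuple r1) k.
Let X k := rx (t k).
Let Y k := ry (t k).

Let size_r1 : N = (\sum_(b <- p) multideg r b)%N.
Proof.
rewrite /N size_filter count_mem_sum; last exact/sorted_root_uniq/dyck_sorted/dp.
by apply: eq_bigr => b _; rewrite ffunE.
Qed.

Let N_gt0 : (0 < N)%N. Proof. by rewrite size_r1; apply: leq_ltn_trans viol. Qed.

Let perm_r : perm_eq r (r2 ++ r1).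
Proof. by rewrite perm_sym perm_catC perm_filterC. Qed.

Let size_r : (size r = size r2 + N)%N.
Proof. by rewrite (perm_size perm_r) size_cat. Qed.

Let map_t : map t (enum 'I_N) = r1.
Proof. exact: (map_tnth_enum (in_tuple r1)). Qed.

Let t_in k : t k \in p.
Proof. by have := mem_tnth k (in_tuple r1); rewrite mem_filter => /andP[]. Qed.

(** Letters off the path stay in front; the starts and ends of those on the path are matched anew by
    [s]. *)
Let term (s : 'S_N) : V := foldr (fun a => rho (root_mx a))
  (word rho v (fun k => lower_unit C (X k) (Y (s k))) (enum 'I_N)) r2.

Let sum_term : B (\sum_s term s).
Proof.
have lij := dyck_leq dp.
pose a0 := mkroot lij.
(* Every letter here is the root vector of alpha_(i,j), so each summand is its N-th power applied to
   v; the violated inequality makes N large enough for [powers]. *)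
have Z0 : filt rho v N.-1 (polar_sum rho v (fun _ : 'I_N => rx a0) (fun _ => ry a0)).
  apply: filt_sum => s _; rewrite /lower_unit rx_lt_ry.
  have -> : forall e : seq 'I_N, word rho v (fun _ => delta_mx (ry a0) (rx a0)) e =
    iter (size e) (rho (root_mx a0)) v by elim=> //= k e ->.
  by rewrite size_enum_ord powers ?size_r1 //; apply: filt_zero.
have bX k : (rx a0 <= X k)%N by have /andP[] := dyck_bounds dp (t_in k).
have bY k : (Y k <= ry a0)%N.
  by rewrite !ryE ltnS; have /andP[] := dyck_bounds dp (t_in k).
have := filt_polar_sum rhoP hwv hw0 (rx_lt_ry a0) bX bY Z0.
move/(filt_word_cat rhoP hwv root_mx r2).
have -> : (size r2 + N.-1 = (size r).-1)%N by rewrite size_r; case: N N_gt0 => // N' _; rewrite addnS.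
move/IHd; congr B; rewrite /term; elim: (r2) => //= a l ->.
by rewrite rep_sum.
Qed.

(** These are the permutations whose words have the multidegree of [r], by the equality case of
    [rearrangement]. *)
Let good (s : 'S_N) := [forall k, X k < Y (s k)]%N &&
  (\sum_k X k * Y (s k) == \sum_k X k * Y k)%N.

Let z (a : posroot n) := (rx a : nat, ry a : nat).

(** Three cases: a letter with x_k >= y_(s k) makes the term zero; a matching with smaller sum has
    smaller area; a matching with equal sum is a reordering of [r], hence agrees with its word
    modulo shorter ones. *)
Let termP s : if good s then B (term s - wd r) else B (term s).
Proof.
have [/forallP lt|/forallPn[k nlt]] := boolP [forall k, X k < Y (s k)]%N; last first.
  rewrite /good; case: forallP => [/(_ k)|_ /=]; first by rewrite (negPf nlt).
  rewrite /term (@word_zero _ _ _ _ rhoP v _ _ _ k) ?mem_enum //.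
    suff -> : foldr (fun a => rho (root_mx a)) 0 r2 = 0 by [].
    by elim: r2 => //= a l ->; apply: rep0.
  by rewrite lower_unit0 // leqNgt.
have [g gP] := fin_all_exists (fun k => posroot_of (lt k)).
pose r1' := map g (enum 'I_N).
have -> : term s = wd (r2 ++ r1').
  rewrite /term /word foldr_cat -/(wd r1') word_map; congr foldr.
  apply: eq_word => k _ /=; have [eX eY] := gP k.
  by rewrite /root_mx /lower_unit lt eX eY.
have sz : size (r2 ++ r1') = size r by rewrite size_cat size_map size_enum_ord size_r.
have sumXY (h : 'I_N -> posroot n) :
    (\sum_(c <- map z (map h (enum 'I_N))) c.1 * c.2 = \sum_k rx (h k) * ry (h k))%N.
  by rewrite 2!big_map big_enum.
have [] := @rearrangement (map z r1) (map z r1').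
- move=> a; rewrite -map_t [LHS]count_map [LHS]count_map [RHS]count_map [RHS]count_map; apply: eq_count => k.
  by have [e _] := gP k; apply: (congr1 (fun x : 'I_n.+1 => (a <= x)%N) e).
- move=> b; rewrite -map_t [LHS]count_map [LHS]count_map [RHS]count_map [RHS]count_map.
  have cs (P : pred 'I_N) : count P (enum 'I_N) = count P (map s (enum 'I_N)).
    apply/seq.permP; rewrite perm_sym; apply: uniq_perm; rewrite ?(map_inj_uniq (@perm_inj _ s)) ?enum_uniq // => k.
    by rewrite mem_enum -(permKV s k) mem_map ?mem_enum //; apply: perm_inj.
  rewrite [RHS]cs [RHS]count_map; apply: eq_count => k.
  by have [_ e] := gP k; apply: (congr1 (fun x : 'I_n.+1 => (b <= x)%N) e).
- move=> _ _ /mapP[a + ->] /mapP[b + ->]; rewrite !mem_filter => /andP[ap _] /andP[bp _].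
  apply/orP; have := sorted_root_comparable (dyck_sorted dp) ap bp.
  case/or3P => [/eqP ->|/root_lt_coord h|/root_lt_coord h]; [|by left|by right].
  by left; apply/andP; split; apply: leqnn.
rewrite -map_t !sumXY.
have sumg : (\sum_k rx (g k) * ry (g k) = \sum_k X k * Y (s k))%N.
  by apply: eq_bigr => k _; have [-> ->] := gP k.
move=> h1 h2.
have le_area : (\sum_k X k * Y (s k) <= \sum_k X k * Y k)%N by rewrite -sumg.
have {h1 h2} eq_area : (\sum_k X k * Y (s k) == \sum_k X k * Y k)%N =
  perm_eq (map z r1') (map z (map t (enum 'I_N))) by rewrite -sumg -h2.
have -> : good s = perm_eq (map z r1') (map z (map t (enum 'I_N))).
  rewrite /good -eq_area; case: forallP => // h; case: h => k; exact: lt.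
have areaE : (area (r2 ++ r1') <= area r ?= iff perm_eq (map z r1') (map z (map t (enum 'I_N))))%N.
  have -> : area r = (area r2 + \sum_k X k * Y k)%N.
    rewrite /area (perm_big _ perm_r) big_cat -map_t; congr (_ + _)%N.
    by rewrite big_map big_enum.
  have -> : area (r2 ++ r1') = (area r2 + \sum_k X k * Y (s k))%N.
    by rewrite -sumg /area big_cat; congr (_ + _)%N; rewrite big_map big_enum.
  by split; rewrite ?leq_add2l ?eqn_add2l.
rewrite map_t in areaE *.
case: ifP => [pm|npm].
  apply: IHd; rewrite -sz; apply: word_perm => // [a|]; first exact: root_mx_nminus.
  rewrite perm_sym (perm_trans perm_r) // perm_cat2l perm_sym.
  by apply: (perm_map_inj _ pm) => a b e; apply: rxy_inj; [exact: (congr1 fst e)|exact: (congr1 snd e)].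
apply: IHarea => //; rewrite ltn_neqAle areaE npm /=; exact: areaE.1.
Qed.

(** The sum of all terms contains the word of [r] once for each good permutation. The identity is
    good, so this number is invertible in characteristic zero. *)
Lemma straightening : B (wd r).
Proof.
have g1 : good 1%g.
  rewrite /good; apply/andP; split; last by under eq_bigr do rewrite perm1.
  by apply/forallP => k; rewrite perm1; apply: rx_lt_ry.
suff : B (#|good|%:R *: wd r).
  move/(BZ #|good|%:R^-1); rewrite scalerA mulVf ?scale1r //.
  by rewrite pnatr_eq0 -lt0n; apply/card_gt0P; exists 1%g.
have -> : #|good|%:R *: wd r = \sum_s term s -
    \sum_s (if good s then term s - wd r else term s).
  rewrite -sumrB scaler_nat -sumr_const big_mkcond /=; apply: eq_bigr => s _.
  by have -> : (s \in good) = good s by []; case: (good s); rewrite ?subrr ?subKr.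
apply: BB => //; apply: big_ind => // s _.
by have := termP s; case: ifP.
Qed.

End Straightening.

(** Induction on the length, then on the area. A word with multidegree in S(lambda) differs from the
    chosen one by shorter words; any other word is straightened along a violated path. *)
Lemma words_in_span r : B (wd r).
Proof.
have [d] := ubnP (size r); elim: d r => // d IHd r; rewrite ltnS => sr.
have [l] := ubnP (area r); elim: l r sr => // l IHl r sr; rewrite ltnS => ar.
have [sS|nS] := pselect (S_lambda m (multideg r)).
  have pm : perm_eq r (w (multideg r)).
    by apply/perm_multideg/ffunP => a; rewrite ![in RHS]ffunE wP.
  (* The empty word is treated apart, since [(size r).-1] is then not below [size r]. *)
  have [r0|r0] := posnP (size r).
    have := BS sS; rewrite (size0nil (etrans (esym (perm_size pm)) r0)).
    by rewrite (size0nil r0).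
  have h := word_perm rhoP hwv root_mx_nminus pm.
  rewrite -(subrK (wd (w (multideg r))) (wd r)); apply: BD; last exact: BS.
  apply: (filt_ind_words B0 BL _ h) => r' sr'; apply: IHd; apply: leq_ltn_trans sr' _.
  by apply: leq_trans sr; rewrite ltn_predL.
have [i [j [p [dp]]]] : exists i j p, dyck_path i j p /\
    ~~ (\sum_(b <- p) multideg r b <= \sum_(k < n | (i <= k <= j)%N) m k)%N.
  apply: contrapT => h; apply: nS => i j p dp; apply: contrapT => /negP h'.
  by apply: h; exists i, j, p.
rewrite -ltnNge => viol.
have r0 : (0 < size r)%N.
  case: (posnP (size r)) => // r0; move: viol; rewrite (size0nil r0).
  by rewrite [X in (_ < X)%N]big1 // => b _; rewrite ffunE.
apply: (straightening _ _ dp viol) => [u|r' sr' ar'].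
  apply: (filt_ind_words B0 BL) => r' sr'; apply: IHd; apply: leq_ltn_trans sr' _.
  by apply: leq_trans sr; rewrite ltn_predL.
by apply: IHl; rewrite ?sr' // (leq_trans ar').
Qed.

End Spanning.

(** * Tensor models *)

Section TensorPower.
Variables (C : numClosedFieldType) (n : nat).
Local Notation M := 'M[C]_n.+1.
Local Notation ix := 'I_n.+1.

(* The tensor power of the natural representation indexed by the finite type P,
   as functions on the set of basis tensors. *)
Definition tensors (P : finType) := {ffun {ffun P -> ix} -> C^o}.

Section OnePower.
Variable P : finType.
Implicit Types (g : {ffun P -> ix}) (p q : P) (b c : ix) (u : tensors P) (x y : M).

Definition fupd g p b : {ffun P -> ix} := [ffun q => if q == p then b else g q].

Lemma fupd_eq g p b : fupd g p b p = b.
Proof. by rewrite ffunE eqxx. Qed.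

Lemma fupd_neq g p q b : q != p -> fupd g p b q = g q.
Proof. by rewrite ffunE => /negPf ->. Qed.

Lemma fupd_fupd g p b c : fupd (fupd g p b) p c = fupd g p c.
Proof. by apply/ffunP => q; rewrite !ffunE; case: eqP. Qed.

Lemma fupd_id g p : fupd g p (g p) = g.
Proof. by apply/ffunP => q; rewrite !ffunE; case: eqP => // ->. Qed.

Lemma fupdC g p q b c : q != p -> fupd (fupd g p b) q c = fupd (fupd g q c) p b.
Proof.
move=> qp; apply/ffunP => r; rewrite !ffunE.
by case: eqP => // ->; rewrite (negPf qp).
Qed.

Definition act x u : tensors P :=
  [ffun g : {ffun _ -> ix} => \sum_p \sum_b x (g p) b * u (fupd g p b)].

(** A composite of two actions consists of terms changing one slot, [act1], and terms changing two
    distinct slots, [act2]; the latter are symmetric in x and y and cancel in the commutator. *)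
Let act1 x u g : C := \sum_p \sum_b x (g p) b * u (fupd g p b).
Let act2 x y u g : C := \sum_p \sum_b \sum_(q | q != p) \sum_c
  x (g p) b * (y (g q) c * u (fupd (fupd g p b) q c)).

Let act_act x y u g : act x (act y u) g = act1 (x *m y) u g + act2 x y u g.
Proof.
rewrite ffunE /act1 /act2 -big_split; apply: eq_bigr => p _ /=.
have -> : \sum_b (x *m y) (g p) b * u (fupd g p b) =
    \sum_b \sum_c x (g p) b * (y b c * u (fupd g p c)).
  rewrite exchange_big; apply: eq_bigr => c _ /=.
  by rewrite mxE mulr_suml; apply: eq_bigr => b _; rewrite mulrA.
rewrite -big_split; apply: eq_bigr => b _ /=.
rewrite ffunE (bigD1 p) //= mulrDr mulr_sumr; congr (_ + _).
  by apply: eq_bigr => c _; rewrite fupd_eq fupd_fupd.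
rewrite mulr_sumr; apply: eq_bigr => q qp; rewrite mulr_sumr.
by apply: eq_bigr => c _; rewrite fupd_neq.
Qed.

Let act2C x y u g : act2 x y u g = act2 y x u g.
Proof.
rewrite /act2 (eq_bigr (fun p => \sum_(q | q != p) \sum_b \sum_c
  x (g p) b * (y (g q) c * u (fupd (fupd g p b) q c)))); last first.
  by move=> p _; rewrite exchange_big.
rewrite [RHS](eq_bigr (fun p => \sum_(q | q != p) \sum_b \sum_c
  y (g p) b * (x (g q) c * u (fupd (fupd g p b) q c)))); last first.
  by move=> p _; rewrite exchange_big.
rewrite (exchange_big_dep xpredT) //=; apply: eq_bigr => p _.
apply: eq_big => [q|q qp]; first by rewrite eq_sym.
rewrite exchange_big; apply: eq_bigr => b _; apply: eq_bigr => c _ /=.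
by rewrite fupdC // mulrCA.
Qed.

Lemma act_rep : gl_rep act.
Proof.
split=> [x c u u'|c x y u|x y u]; apply/ffunP => g.
- rewrite !ffunE /= scaler_sumr -big_split; apply: eq_bigr => p _ /=.
  rewrite scaler_sumr -big_split; apply: eq_bigr => b _ /=.
  by rewrite !ffunE mulrDr; congr (_ + _); rewrite -mulrCA.
- rewrite !ffunE /= scaler_sumr -big_split; apply: eq_bigr => p _ /=.
  rewrite scaler_sumr -big_split; apply: eq_bigr => b _ /=.
  by rewrite !mxE mulrDl; congr (_ + _); rewrite -mulrA.
- rewrite [RHS]ffunE [X in _ + X]ffunE !act_act act2C opprD addrACA subrr addr0.
  rewrite ffunE /act1 -sumrB; apply: eq_bigr => p _.
  by rewrite -sumrB; apply: eq_bigr => b _; rewrite -mulrBl !mxE.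
Qed.

(** The Hermitian form for which the basis tensors are orthonormal; the adjoint of a matrix is its
    conjugate transpose. *)
Definition form u u' : C := \sum_g u g * (u' g)^*.

Lemma form_linl (c : C) u1 u2 u' : form (c *: u1 + u2) u' = c * form u1 u' + form u2 u'.
Proof.
rewrite /form mulr_sumr -big_split; apply: eq_bigr => g _ /=.
by rewrite !ffunE mulrDl mulrA.
Qed.

Lemma form0l u' : form 0 u' = 0.
Proof. by rewrite /form big1 // => g _; rewrite ffunE mul0r. Qed.

Lemma form_adj x y u u' : (forall a b, y a b = (x b a)^*) ->
  form (act x u) u' = form u (act y u').
Proof.
move=> xy; rewrite /form.
under eq_bigr => g _ do rewrite ffunE mulr_suml.
under [RHS]eq_bigr => g _ do rewrite ffunE rmorph_sum mulr_sumr /=.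
rewrite exchange_big [RHS]exchange_big; apply: eq_bigr => p _ /=.
under eq_bigr => g _ do rewrite mulr_suml.
under [RHS]eq_bigr => g _ do rewrite rmorph_sum mulr_sumr /=.
rewrite pair_big [RHS]pair_big /=.
(* A tensor together with a new value at slot p is exchanged with the updated tensor and the old
   value, which transposes the matrix entry. *)
pose swap (z : {ffun P -> ix} * ix) := (fupd z.1 p z.2, z.1 p).
have swapK : involutive swap.
  by case=> g b; rewrite /swap /= fupd_fupd fupd_eq fupd_id.
rewrite (reindex_inj (inv_inj swapK)) /=; apply: eq_bigr => -[g b] _ /=.
by rewrite fupd_eq fupd_fupd fupd_id xy [(_ * u' _)^*]rmorphM /= conjCK mulrCA mulrA.
Qed.

Lemma form_def u : form u u = 0 -> u = 0.
Proof.
move=> u0; apply/ffunP => g; rewrite ffunE; apply/eqP.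
have ge0 h : true -> 0 <= u h * (u h)^* by rewrite mul_conjC_ge0.
by have /eqP := psumr_eq0P ge0 u0 (isT : true) (i := g); rewrite mul_conjC_eq0.
Qed.

Lemma act_root a u g :
  act (root_mx C a) u g = \sum_(p | g p == ry a) u (fupd g p (rx a)).
Proof.
rewrite ffunE [RHS]big_mkcond; apply: eq_bigr => p _ /=.
rewrite (bigD1 (rx a)) //= big1 => [|b ba]; last first.
  by rewrite mxE (negPf ba) andbF mul0r.
by rewrite addr0 mxE eqxx andbT; case: ifP; rewrite ?mul1r ?mul0r.
Qed.

End OnePower.

(** * Tensor products and splittings of words *)

Section Product.
Variables P1 P2 : finType.

Definition restr1 (g : {ffun P1 + P2 -> ix}) : {ffun P1 -> ix} := [ffun p => g (inl p)].
Definition restr2 (g : {ffun P1 + P2 -> ix}) : {ffun P2 -> ix} := [ffun p => g (inr p)].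
Definition glue (g1 : {ffun P1 -> ix}) (g2 : {ffun P2 -> ix}) : {ffun P1 + P2 -> ix} :=
  [ffun p => match p with inl p => g1 p | inr p => g2 p end].

Lemma restr1_glue g1 g2 : restr1 (glue g1 g2) = g1.
Proof. by apply/ffunP => p; rewrite !ffunE. Qed.
Lemma restr2_glue g1 g2 : restr2 (glue g1 g2) = g2.
Proof. by apply/ffunP => p; rewrite !ffunE. Qed.

Definition tens (u1 : tensors P1) (u2 : tensors P2) : tensors (P1 + P2)%type :=
  [ffun g : {ffun _ -> ix} => u1 (restr1 g) * u2 (restr2 g)].

Lemma act_tens x u1 u2 : act x (tens u1 u2) = tens (act x u1) u2 + tens u1 (act x u2).
Proof.
apply/ffunP => g; rewrite !ffunE big_sumType /= mulr_suml mulr_sumr.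
congr (_ + _); apply: eq_bigr => p _.
  rewrite mulr_suml; apply: eq_bigr => b _; rewrite !ffunE mulrA; congr (_ * u1 _ * u2 _).
    by apply/ffunP => q; rewrite !ffunE.
  by apply/ffunP => q; rewrite !ffunE.
rewrite mulr_sumr; apply: eq_bigr => b _; rewrite !ffunE mulrCA; congr (u1 _ * (_ * u2 _)).
  by apply/ffunP => q; rewrite !ffunE.
by apply/ffunP => q; rewrite !ffunE.
Qed.

(** The iterated coproduct: each letter acts either on the first or on the second tensor factor. *)
Fixpoint splits (T : Type) (r : seq T) : seq (seq T * seq T) :=
  if r is a :: r' then
    [seq (a :: z.1, z.2) | z <- splits r'] ++ [seq (z.1, a :: z.2) | z <- splits r']
  else [:: ([::], [::])].

Lemma word_tens (K : Type) (h : K -> M) r u1 u2 :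
  word (@act _) (tens u1 u2) h r =
  \sum_(z <- splits r) tens (word (@act _) u1 h z.1) (word (@act _) u2 h z.2).
Proof.
elim: r => [|a r IH] /=; first by rewrite big_seq1.
rewrite IH rep_sum; last exact: act_rep.
by rewrite big_cat /= !big_map -big_split; apply: eq_bigr => z _; rewrite act_tens.
Qed.

End Product.

Lemma splits_count (T : eqType) (r : seq T) z Q : z \in splits r ->
  count Q r = (count Q z.1 + count Q z.2)%N.
Proof.
elim: r z => [|a r IH] z /=; first by rewrite inE => /eqP ->.
rewrite mem_cat => /orP[] /mapP[z' /IH -> ->] /=; first by rewrite addnA.
by rewrite addnCA.
Qed.

End TensorPower.

(** * Exterior powers, the models of the fundamental weights *)

Section Fundamental.
Variables (C : numClosedFieldType) (n k : nat).
Hypothesis kn : (k <= n)%N.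
Local Notation M := 'M[C]_n.+1.
Local Notation ix := 'I_n.+1.
Local Notation grid := {ffun 'I_k -> 'I_n.+1}.
Implicit Types (g : grid).

Definition det_mx g : 'M[C]_k := \matrix_(i, j) (g i == j :> nat)%:R.

(** The wedge of the first k basis vectors: its coordinate at g is a sign if g permutes the first k
    indices, and 0 otherwise. *)
Definition fund_vec : tensors C n 'I_k := [ffun g : grid => \det (det_mx g)].

Definition emb (j : 'I_k) : ix := widen_ord (leqW kn) j.

Lemma det_mx_row g (i : 'I_k) b j : det_mx (fupd g i b) i j = (b == j :> nat)%:R.
Proof. by rewrite mxE fupd_eq. Qed.

Lemma cofactor_fupd g i b j : cofactor (det_mx (fupd g i b)) i j = cofactor (det_mx g) i j.
Proof.
rewrite /cofactor; congr (_ * \det _); apply/matrixP => i' j'.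
by rewrite !mxE fupd_neq // eq_sym neq_lift.
Qed.

(** Cofactor expansion along the updated row turns the coordinate into tr(G X adj G) with G =
    [det_mx g], that is det G times tr X. The hypothesis on x says that the span of the first k
    basis vectors is stable. *)
Lemma act_fund (x : M) : (forall a b : ix, (k <= a)%N -> (b < k)%N -> x a b = 0) ->
  act x fund_vec = (\sum_(j < k) x (emb j) (emb j)) *: fund_vec.
Proof.
move=> xP; pose X : 'M[C]_k := \matrix_(l, j) x (emb l) (emb j).
apply/ffunP => g; rewrite !ffunE.
transitivity (\tr (det_mx g *m X *m \adj (det_mx g))).
  apply: eq_bigr => i _; rewrite mxE.
  transitivity (\sum_b \sum_(j < k) x (g i) b * ((b == j :> nat)%:R * cofactor (det_mx g) i j)).
    apply: eq_bigr => b _; rewrite ffunE (expand_det_row _ i) mulr_sumr.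
    by apply: eq_bigr => j _; rewrite det_mx_row cofactor_fupd.
  rewrite exchange_big; apply: eq_bigr => j _ /=.
  rewrite (bigD1 (emb j)) //= eqxx mul1r big1 ?addr0 => [|b bj]; last first.
    by rewrite (_ : (b == j :> nat) = false) ?mul0r ?mulr0 //; apply/negbTE.
  rewrite [\adj _ _ _]mxE; congr (_ * _); rewrite mxE.
  have [gk|gk] := ltnP (g i) k; last first.
    rewrite (xP _ (emb j) gk (ltn_ord j)) big1 // => l _; rewrite mxE (_ : (_ == _) = false) ?mul0r //.
    by rewrite gtn_eqF // (leq_trans _ gk).
  rewrite (bigD1 (Ordinal gk)) //= big1 ?addr0 => [|l lg]; last first.
    rewrite mxE (_ : (_ == _) = false) ?mul0r //.
    by apply: contraNF lg => /eqP e; apply/eqP/val_inj.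
  by rewrite !mxE eqxx mul1r; congr (x _ _); apply/val_inj.
rewrite mxtrace_mulC mulmxA mul_adj_mx mul_scalar_mx mxtraceZ [RHS]mulrC.
by congr (_ * _); apply: eq_bigr => j _; rewrite mxE.
Qed.

(** A nonzero determinant forces g to be a bijection onto the first k indices. *)
Lemma fund_vec_hist g (z : ix) : fund_vec g != 0 -> #|[pred i | g i == z]| = (z < k)%N :> nat.
Proof.
rewrite ffunE => dn0.
have gk i : (g i < k)%N.
  rewrite ltnNge; apply: contra dn0 => kg; rewrite (expand_det_row _ i) big1 // => j _.
  by rewrite mxE gtn_eqF ?mul0r // (leq_trans _ kg).
have ginj : injective g.
  move=> i i' e; apply: contraNeq dn0 => ne; apply/eqP.
  by apply: (determinant_alternate ne) => j; rewrite !mxE e.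
have [zk|kz] := ltnP z k; last first.
  apply: eq_card0 => i; rewrite !inE; apply/negbTE; apply: contraTneq (gk i) => ->.
  by rewrite -leqNgt.
pose h (i : 'I_k) := Ordinal (gk i).
have hinj : injective h by move=> i i' /(congr1 val) /= /val_inj /ginj.
have /codomP[i ei] : Ordinal zk \in codom h by rewrite (injF_onto hinj).
rewrite [RHS]/= -(card1 i); apply: eq_card => i'; rewrite !inE.
have -> : z = g i by apply/val_inj; rewrite /= -[RHS]/(val (h i)) -ei.
exact: inj_eq.
Qed.

Local Notation wd := (word (@act C n 'I_k) fund_vec (@root_mx C n)).

(** A balance of indices: each letter a turns one index [rx a] into [ry a]. *)
Lemma word_fund_hist r g (z : ix) : wd r g != 0 ->
  (#|[pred i | g i == z]| + count (fun a => rx a == z) r =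
   (z < k) + count (fun a => ry a == z) r)%N.
Proof.
elim: r g => [|a r IH] g /=; first by rewrite !addn0; apply: fund_vec_hist.
rewrite act_root => s0.
have [i gi gn0] : exists2 i, g i = ry a & wd r (fupd g i (rx a)) != 0.
  have [/existsP[i /andP[/eqP ? ?]]|/existsPn h] :=
    boolP [exists i, (g i == ry a) && (wd r (fupd g i (rx a)) != 0)]; first by exists i.
  case/eqP: s0; apply: big1 => i gi.
  by have := h i; rewrite gi /= negbK => /eqP.
have := IH _ gn0.
rewrite (cardD1 i) [in X in _ -> X](cardD1 i) !inE fupd_eq gi.
rewrite (@eq_card _ [predD1 [pred i0 | fupd g i (rx a) i0 == z] & i]
  [predD1 [pred i0 | g i0 == z] & i]); first by move=> e; rewrite [RHS]addnCA -e -!addnA; congr addn; rewrite addnCA.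
by move=> i'; rewrite !inE; case: eqVneq => // ne; rewrite fupd_neq.
Qed.

(** These roots involve the k-th simple root; their root vectors move one of the first k indices
    beyond them. *)
Definition straddle (a : posroot n) := (rx a < k <= ry a)%N.

(** For a straddling root the balance at the index [rx a] forbids a second use. Any other root
    vector stabilizes the span of the first k basis vectors with zero diagonal, hence kills the
    wedge. *)
Lemma word_fund_power a N : (straddle a < N)%N -> wd (nseq N a) = 0.
Proof.
move=> aN; case sa: (straddle a) aN => aN.
  have /andP[xk ky] := sa.
  apply/ffunP => g; rewrite [RHS]ffunE; apply/eqP; apply: contraLR aN => /word_fund_hist.
  move=> /(_ (rx a)); rewrite !count_nseq /= eqxx mul1n xk.
  rewrite (_ : (ry a == rx a) = false) ?mul0n; first by lia.
  by apply/negbTE; rewrite -val_eqE /= gtn_eqF // rx_lt_ry.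
case: N aN => // N _; elim: N => [|N IH]; last first.
  rewrite [wd _]/(act (root_mx C a) (wd (nseq N.+1 a))) IH.
  exact: (rep0 (act_rep C n 'I_k)).
rewrite /= act_fund => [|b c kb ck]; last first.
  rewrite mxE; case: eqP => //= eb; case: eqP => //= ec.
  by move: sa; rewrite /straddle -eb -ec kb ck.
rewrite big1 ?scale0r // => j _; rewrite mxE; case: eqP => //= e; case: eqP => //= e'.
by have := rx_lt_ry a; rewrite -e -e' ltnn.
Qed.

Definition matching (r : seq (posroot n)) :=
  [/\ {in r, forall a, straddle a}, uniq r,
      {in r &, injective (@rx n)} & {in r &, injective (@ry n)}].

(** The extremal basis tensor of the matching: in the identity, each index [rx a] is moved to
    [ry a]. *)
Definition matching_fun (r : seq (posroot n)) : grid :=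
  [ffun i => if [pick a | (a \in r) && (rx a == emb i)] is Some a then ry a else emb i].

Lemma matching_fun_in r a i : matching r -> a \in r -> rx a = emb i -> matching_fun r i = ry a.
Proof.
move=> [_ _ xr _] ar ai; rewrite ffunE; case: pickP => [b /andP[br /eqP bi]|/(_ a)].
  by congr ry; apply: xr => //; rewrite bi.
by rewrite ar ai eqxx.
Qed.

Lemma matching_fun_out r i : {in r, forall a, rx a != emb i} -> matching_fun r i = emb i.
Proof.
move=> h; rewrite ffunE; case: pickP => // b /andP[/h bi].
by rewrite (negPf bi).
Qed.

Lemma eq_matching_fun r r' : r =i r' -> matching_fun r = matching_fun r'.
Proof.
move=> e; apply/ffunP => i; rewrite !ffunE.
by congr (if _ is Some _ then _ else _); apply: eq_pick => a; rewrite /= e.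
Qed.

(** The index [ry a] occurs in a single slot of the target, and undoing the move there leaves the
    target of the remaining matching; so exactly one term contributes at each letter. *)
Lemma word_matching r : matching r -> wd r (matching_fun r) = 1.
Proof.
elim: r => [|a r IH] mr /=.
  rewrite ffunE (_ : det_mx _ = 1%:M) ?det1 //; apply/matrixP=> i j.
  by rewrite !mxE matching_fun_out.
have [sr /andP[ar ur] xr yr] := mr.
have mr' : matching r.
  split=> // [b br|b c br cr|b c br cr]; first by apply: sr; rewrite inE br orbT.
    by apply: xr; rewrite inE ?br ?cr orbT.
  by apply: yr; rewrite inE ?br ?cr orbT.
have /andP[xk ky] := sr a (mem_head _ _).
pose i0 := Ordinal xk; have ei0 : rx a = emb i0 by apply/val_inj.
rewrite act_root (bigD1 i0) /=; last first.
  by apply/eqP; apply: matching_fun_in => //; rewrite mem_head.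
rewrite big1 ?addr0 => [|i /andP[/eqP e ii0]]; last first.
  have [b /andP[br /eqP bi]|h] := pickP [pred b | (b \in a :: r) && (rx b == emb i)].
    move: e; rewrite (matching_fun_in mr br bi) => /(yr _ _ br (mem_head _ _)) eba.
    case/eqP: ii0; apply/val_inj.
    by rewrite /= -[RHS]/(val (emb i0)) -ei0 -eba bi.
  move: ky; rewrite -e matching_fun_out => [|b br]; last by have := h b; rewrite /= br /= => ->.
  by rewrite /= leqNgt ltn_ord.
rewrite (_ : fupd _ _ _ = matching_fun r) ?IH //; apply/ffunP => i.
have [->|ne] := eqVneq i i0.
  rewrite fupd_eq matching_fun_out // => b br; rewrite -ei0.
  apply: contraNneq ar => /xr <- //; by rewrite inE ?br ?eqxx ?orbT.
rewrite fupd_neq // !ffunE; congr (if _ is Some _ then _ else _); apply: eq_pick => b /=.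
rewrite inE andb_orl; case: eqVneq => // -> /=.
rewrite (_ : (rx a == emb i) = false) //; apply: contraNF ne; rewrite ei0 => /eqP e.
by apply/eqP/val_inj; rewrite -[LHS]/(val (emb i)) -e.
Qed.

End Fundamental.

(** * Antichains minimize the cost *)

Section Cost.
Local Open Scope nat_scope.
Variable n : nat.
Implicit Types (a b : posroot n) (r : seq (posroot n)).

(* The summand max_cost makes longer words more expensive; among words of equal
   length and equal marginals, nested matchings are the cheapest. *)
Definition max_cost := (n * n * n.+1).+1.
Definition cost_root a := max_cost - rx a * (n - ry a).
Definition cost r := \sum_(a <- r) cost_root a.
Definition anti r := {in r &, forall a b, ~~ root_lt a b}.

(** Reversing the second coordinate turns antichains of roots into chains of the grid, to which
    [rearrangement] applies. *)
Let z a : nat * nat := (rx a : nat, n - ry a).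

Lemma leq_coord a : rx a * (n - ry a) <= n * n.
Proof. by rewrite leq_mul ?leq_subr // -ltnS. Qed.

Lemma cost_area r : cost r + \sum_(c <- map z r) c.1 * c.2 = size r * max_cost.
Proof.
rewrite big_map /cost; elim: r => [|a r IH]; first by rewrite !big_nil.
rewrite !big_cons /= mulSn -IH addnACA; congr (_ + _).
rewrite /cost_root subnK // (leq_trans (leq_coord a)) // /max_cost.
by rewrite leqW // leq_pmulr.
Qed.

Lemma count_fiber (T : Type) (I : finType) (f : T -> I) (Q : pred I) (l : seq T) :
  \sum_(i | Q i) count (fun t => f t == i) l = count (Q \o f) l.
Proof.
elim: l => [|a l IH] /=; first by rewrite big1.
rewrite big_split /= IH; congr (_ + _); case Qa: (Q (f a)).
  by rewrite (bigD1 (f a)) //= eqxx big1 // => i /andP[_ /negPf]; rewrite eq_sym => ->.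
by rewrite big1 // => i Qi; case: eqP => // e; rewrite e Qi in Qa.
Qed.

Lemma root_lt_total a b : rx a <= rx b -> ry a <= ry b -> (a == b) || root_lt a b.
Proof.
by move=> h1 h2; have [//|ne] := eqVneq a b; apply/and3P; split => //.
Qed.

(** The balance of indices forces exactly [size r0] letters of [r] to straddle k. Additional letters
    make [r] strictly more expensive; without them [r] has the marginals of [r0], and the
    rearrangement inequality compares the two. *)
Lemma matching_cost k r0 r : matching k r0 -> anti r0 -> k <= n ->
  (forall i : 'I_n.+1, count (fun a => rx a == i) r + count (fun a => ry a == i) r0 =
                       count (fun a => rx a == i) r0 + count (fun a => ry a == i) r) ->
  cost r0 <= cost r /\ (cost r <= cost r0 -> perm_eq r r0).
Proof.
move=> [sr0 ur0 xr0 yr0] ar0 kn h.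
have s0 : size r0 <= n.
  rewrite (leq_trans _ kn) // -(size_map (fun a => rx a : nat)) -[k in _ <= k](size_iota 0).
  apply: uniq_leq_size.
    by rewrite map_inj_in_uniq // => a b ar br /val_inj; apply: xr0.
  by move=> _ /mapP[a ar ->]; rewrite mem_iota; have /andP[] := sr0 a ar.
(* The balance summed over all indices i >= k, where [r0] has all its ends and none of its
   starts. *)
have hk : count (fun a => k <= rx a) r + size r0 = count (fun a => k <= ry a) r.
  have : \sum_(i : 'I_n.+1 | k <= i) (count (fun a => rx a == i) r + count (fun a => ry a == i) r0) =
    \sum_(i : 'I_n.+1 | k <= i) (count (fun a => rx a == i) r0 + count (fun a => ry a == i) r).
    by apply: eq_bigr => i _; apply: h.
  rewrite !big_split /= !count_fiber.
  rewrite (_ : count _ r0 = size r0); last first.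
    by apply/eqP; rewrite -all_count; apply/allP => a /sr0 /andP[].
  rewrite (_ : count _ r0 = 0) //; last first.
    by apply/eqP; rewrite -leqn0 leqNgt -has_count; apply/hasPn => a /sr0 /andP[+ _] /=; rewrite -ltnNge.
have hs : count (straddle k) r = size r0.
  have : count (fun a => k <= ry a) r = count (fun a => k <= rx a) r + count (straddle k) r.
    elim: (r) => //= a l ->.
    have -> : (k <= ry a) = (k <= rx a) + straddle k a :> nat.
      by have := rx_lt_ry a; rewrite /straddle; lia.
    by rewrite addnACA.
  rewrite -hk; lia.
have : size r0 <= size r by rewrite -hs count_size.
rewrite leq_eqVlt => /predU1P[sz|sz]; last first.
  have lt : cost r0 < cost r.
    have := cost_area r0; have := cost_area r.
    have : \sum_(c <- map z r) c.1 * c.2 <= size r * (n * n).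
      rewrite big_map -sum1_size big_distrl; apply: leq_sum => a _ /=.
      by rewrite mul1n; apply: leq_coord.
    rewrite /max_cost; nia.
  by split; [apply: ltnW|rewrite leqNgt lt].
have sr : {in r, forall a, straddle k a} by apply/allP; rewrite all_count hs sz.
have hx (i : 'I_n.+1) : count (fun a => rx a == i) r = count (fun a => rx a == i) r0.
  have [ik|ki] := ltnP i k.
    have cy0 r' : {in r', forall a, straddle k a} -> count (fun a => ry a == i) r' = 0.
      move=> sr'; apply/eqP; rewrite -leqn0 leqNgt -has_count; apply/hasPn => a /sr' /andP[_ ky].
      by apply: contraTneq ky => ->; rewrite -ltnNge.
    by have := h i; rewrite !cy0 // !addn0.
  have cx0 r' : {in r', forall a, straddle k a} -> count (fun a => rx a == i) r' = 0.
    move=> sr'; apply/eqP; rewrite -leqn0 leqNgt -has_count; apply/hasPn => a /sr' /andP[xk _].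
    by apply: contraTneq xk => ->; rewrite -leqNgt.
  by rewrite !cx0.
have hy (i : 'I_n.+1) : count (fun a => ry a == i) r = count (fun a => ry a == i) r0.
  by have := h i; rewrite hx => /eqP; rewrite eqn_add2l => /eqP.
have px : perm_eq (map (@rx n) r) (map (@rx n) r0).
  by apply/allP => i _ /=; rewrite !count_map; apply/eqP/hx.
have py : perm_eq (map (@ry n) r) (map (@ry n) r0).
  by apply/allP => i _ /=; rewrite !count_map; apply/eqP/hy.
have [|||le e] := @rearrangement (map z r0) (map z r).
- move=> c; rewrite !count_map.
  by have /seq.permP/(_ (fun x => c <= x)) := px; rewrite !count_map.
- move=> c; rewrite !count_map.
  by have /seq.permP/(_ (fun y => c <= n - y)) := py; rewrite !count_map.
- move=> _ _ /mapP[a ar ->] /mapP[b br ->].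
  have nab := negPf (ar0 _ _ ar br); have nba := negPf (ar0 _ _ br ar).
  have tot c d : c \in r0 -> d \in r0 -> rx c <= rx d -> n - ry c <= n - ry d.
    move=> cr dr h1; have [h2|h2] := leqP (ry c) (ry d); last by rewrite leq_sub2l // ltnW.
    by have := root_lt_total h1 h2; rewrite (negPf (ar0 _ _ cr dr)) orbF => /eqP ->.
  apply/orP; case: (leqP (rx a) (rx b)) => [h1|/ltnW h1]; [left|right]; apply/andP; split => //; exact: tot.
have := cost_area r0; have := cost_area r; rewrite sz => c1 c2.
split; first by lia.
move=> le'; suff : perm_eq (map z r) (map z r0).
  move=> pm; apply: (perm_map_inj _ pm) => a b e'.
  apply: rxy_inj; first exact: (congr1 fst e').
  have e2 : n - ry a = n - ry b := congr1 snd e'.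
  have := ltn_ord (ry a); have := ltn_ord (ry b); lia.
rewrite -e; lia.
Qed.

End Cost.

(** * Tensor models of dominant weights and their products *)

Section Models.
Variables (C : numClosedFieldType) (n : nat).
Local Notation M := 'M[C]_n.+1.
Local Notation grid P := {ffun P -> 'I_n.+1}.

Definition costs (s : multiexp n) := (\sum_a cost_root a * s a)%N.
Definition madd (s t : multiexp n) : multiexp n := [ffun a => (s a + t a)%N].

Lemma cost_multideg r : cost r = costs (multideg r).
Proof.
rewrite /cost /costs; elim: r => [|a r IH].
  by rewrite big_nil big1 // => a _; rewrite ffunE muln0.
rewrite big_cons IH [RHS](bigD1 a) //= [X in (_ + X)%N](bigD1 a) //= addnA.
congr (_ + _)%N; first by rewrite !ffunE /= eqxx mulnDr muln1.
by apply: eq_bigr => b ba; rewrite !ffunE /= [a == b]eq_sym (negPf ba).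
Qed.

Lemma costs_madd s t : costs (madd s t) = (costs s + costs t)%N.
Proof. by rewrite /costs -big_split; apply: eq_bigr => a _; rewrite ffunE mulnDr. Qed.

Lemma splits_multideg r z : z \in splits r -> multideg r = madd (multideg z.1) (multideg z.2).
Proof. by move=> zr; apply/ffunP => a; rewrite !ffunE (splits_count _ zr). Qed.

(** Each letter goes to the first factor as long as [s] still demands it. *)
Lemma ex_split s t r : multideg r = madd s t ->
  exists z, [/\ z \in splits r, multideg z.1 = s & multideg z.2 = t].
Proof.
elim: r s t => [|a r IH] s t /ffunP e.
  exists ([::], [::]); split; first by rewrite inE.
    by apply/ffunP => b; have := e b; rewrite !ffunE /=; lia.
  by apply/ffunP => b; have := e b; rewrite !ffunE /=; lia.
have [sa|sa] := posnP (s a).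
  have [|z [zr e1 e2]] := IH s [ffun b => t b - (b == a)]%N.
    apply/ffunP => b; have := e b; rewrite !ffunE /= eq_sym.
    by have := e a; rewrite !ffunE /= eqxx sa; case: eqVneq => [->|_]; lia.
  exists (z.1, a :: z.2); split=> //=.
    by rewrite mem_cat; apply/orP; right; apply/mapP; exists z.
  apply/ffunP => b; have := e b; move/ffunP/(_ b): e2; move/ffunP/(_ b): e1.
  rewrite !ffunE /= eq_sym => e1 e2; have := splits_count (pred1 b) zr.
  by have := e a; rewrite !ffunE /= eqxx sa; move: e1 e2; case: eqVneq => [->|_]; lia.
have [|z [zr e1 e2]] := IH [ffun b => s b - (b == a)]%N t.
  apply/ffunP => b; have := e b; rewrite !ffunE /= eq_sym.
  by case: eqVneq => [->|_]; lia.
exists (a :: z.1, z.2); split=> //=.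
  by rewrite mem_cat; apply/orP; left; apply/mapP; exists z.
apply/ffunP => b; move/ffunP/(_ b): e1.
by rewrite !ffunE /= eq_sym; case: eqVneq => [<-|_]; lia.
Qed.

Section OneModel.
Variables (m : 'I_n -> nat) (S : multiexp n -> Prop) (P : finType) (v : tensors C n P).
Local Notation wd := (word (@act C n P) v (@root_mx C n)).

(** The facts about the tensor vector used in the comparison with V: its weight under the Borel
    subalgebra, the vanishing root powers, and for each s a coordinate in which s is the strict
    minimum of the cost. *)
Record model : Prop := Model {
  model_upper : forall x : M, upper x ->
    act x v = (\sum_(k < n) (m k)%:R * \sum_(j < n.+1 | (j <= k)%N) x j j) *: v;
  model_power : forall (a : posroot n) N,
    (\sum_(k < n | ((val a).1 <= k <= (val a).2)%N) m k < N)%N -> wd (nseq N a) = 0;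
  (* Positivity, rather than nonvanishing, prevents cancellations between the
     splittings of a word over a tensor product. *)
  model_coef : forall s, S s -> exists g, forall r,
    (wd r g != 0 -> (costs s <= costs (multideg r))%N /\
      ((costs (multideg r) <= costs s)%N -> multideg r = s)) /\
    (multideg r = s -> 0 < wd r g) }.

End OneModel.

Lemma splits_nseq N (a : posroot n) z : z \in splits (nseq N a) ->
  exists N1 N2, [/\ z.1 = nseq N1 a, z.2 = nseq N2 a & N = (N1 + N2)%N].
Proof.
move=> zr; have c := splits_count (predC1 a) zr.
have s := splits_count predT zr; rewrite !count_predT size_nseq in s.
rewrite count_nseq /= eqxx mul0n in c.
have all_a (r : seq (posroot n)) : count (predC1 a) r = 0%N -> r = nseq (size r) a.
  move=> r0; apply/all_pred1P; rewrite -[all _ _]negbK -has_predC has_count -leqNgt.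
  by rewrite leqn0 -[X in _ == X]r0.
move/esym/eqP: c; rewrite addn_eq0 => /andP[/eqP c1 /eqP c2].
by exists (size z.1), (size z.2); split=> //; apply: all_a.
Qed.

(** At a glued coordinate the word is a sum over its splittings. A nonzero term satisfies the cost
    inequality in both factors; costs add up, so overall equality forces equality in each. In
    multidegree s all nonzero terms are positive, and [ex_split] provides one. *)
Lemma model_tens m1 m2 (S1 S2 S : multiexp n -> Prop) (P1 P2 : finType)
    (v1 : tensors C n P1) (v2 : tensors C n P2) :
  (forall s, S s -> exists s1 s2, [/\ S1 s1, S2 s2 & s = madd s1 s2]) ->
  model m1 S1 v1 -> model m2 S2 v2 ->
  model (fun k => m1 k + m2 k)%N S (tens v1 v2).
Proof.
move=> SS [up1 pw1 co1] [up2 pw2 co2]; split.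
- move=> x xP; rewrite act_tens up1 // up2 //; apply/ffunP => g; rewrite !ffunE /=.
  set c1 := \sum_k _; set c2 := \sum_k _.
  have -> : \sum_(k < n) (m1 k + m2 k)%:R * (\sum_(j < n.+1 | (j <= k)%N) x j j) = c1 + c2.
    by rewrite -big_split; apply: eq_bigr => k _; rewrite natrD mulrDl.
  by rewrite [RHS]mulrDl; congr (_ + _); rewrite -?mulrA // mulrCA.
- move=> a N; rewrite big_split /= => aN; rewrite word_tens big_seq big1 // => z zr.
  have [N1 [N2 [-> -> eN]]] := splits_nseq zr.
  apply/ffunP => g; rewrite !ffunE.
  have [lt1|le1] := ltnP (\sum_(k < n | ((val a).1 <= k <= (val a).2)%N) m1 k) N1.
    by rewrite pw1 // ffunE mul0r.
  rewrite pw2 ?ffunE ?mulr0 // -(ltn_add2l N1) -eN.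
  by apply: leq_ltn_trans aN; rewrite leq_add2r.
have arith (a1 a2 b1 b2 : nat) : (a1 <= b1)%N -> (a2 <= b2)%N -> (b1 + b2 <= a1 + a2)%N ->
  (b1 <= a1)%N /\ (b2 <= a2)%N by lia.
move=> s /SS [s1 [s2 [/co1[g1 h1] /co2[g2 h2] es]]]; exists (glue g1 g2) => r.
have -> : word (@act C n _) (tens v1 v2) (@root_mx C n) r (glue g1 g2) =
  \sum_(z <- splits r) word (@act C n P1) v1 (@root_mx C n) z.1 g1 *
                       word (@act C n P2) v2 (@root_mx C n) z.2 g2.
  rewrite word_tens sum_ffunE; apply: eq_bigr => z _.
  by rewrite ffunE restr1_glue restr2_glue.
split=> [n0|er].
  have [z zr] : exists2 z, z \in splits r & (word (@act C n P1) v1 (@root_mx C n) z.1 g1 *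
                       word (@act C n P2) v2 (@root_mx C n) z.2 g2 != 0).
    apply: contrapT => h; case/eqP: n0; rewrite big_seq big1 // => z zr.
    by apply/eqP; apply: contrapT => /negP nz; apply: h; exists z.
  rewrite mulf_eq0 negb_or => /andP[/(proj1 (h1 _)) [l1 e1] /(proj1 (h2 _)) [l2 e2]].
  rewrite (splits_multideg zr) es !costs_madd; split; first exact: leq_add.
  by move=> le; have [le1 le2] := arith _ _ _ _ l1 l2 le; rewrite (e1 le1) (e2 le2).
have [z0 [z0r e01 e02]] := ex_split (etrans er es).
have ge0 z : z \in splits r -> 0 <= word (@act C n P1) v1 (@root_mx C n) z.1 g1 *
                       word (@act C n P2) v2 (@root_mx C n) z.2 g2.
  move=> zr; set c := _ * _; have [->//|] := eqVneq c 0.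
  rewrite mulf_eq0 negb_or => /andP[/(proj1 (h1 _)) [l1 e1] /(proj1 (h2 _)) [l2 e2]].
  have := congr1 costs er; rewrite (splits_multideg zr) es !costs_madd => ec.
  have [le1 le2] := arith _ _ _ _ l1 l2 (eq_leq ec).
  by apply/ltW/mulr_gt0; [apply/(proj2 (h1 _))/e1|apply/(proj2 (h2 _))/e2].
rewrite (big_rem z0 z0r) /=; apply: ltr_wpDr.
  by rewrite big_seq; apply: sumr_ge0 => z /mem_rem /ge0.
by apply: mulr_gt0; [apply/(proj2 (h1 _))|apply/(proj2 (h2 _))].
Qed.

Lemma model_zero (S : multiexp n -> Prop) :
  (forall s, S s -> s = [ffun=> 0%N]) ->
  model (fun _ => 0%N) S ([ffun _ => 1] : tensors C n 'I_0).
Proof.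
move=> S0; have act0 (x : M) (u : tensors C n 'I_0) : act x u = 0.
  by apply/ffunP => g; rewrite !ffunE big_ord0.
split.
- by move=> x _; rewrite act0 big1 ?scale0r // => k _; rewrite mul0r.
- by move=> a [|N] //= _; rewrite act0.
move=> s /S0 ->; exists [ffun _ => ord0] => r; split.
  case: r => [_|a r]; last by rewrite /= act0 ffunE eqxx.
  have -> : multideg [::] = [ffun=> 0%N] :> multiexp n by apply/ffunP => a; rewrite !ffunE.
  by split.
case: r => [_|a r /ffunP/(_ a)]; first by rewrite ffunE ltr01.
by rewrite !ffunE /= eqxx.
Qed.

(** The set S(omega_i) for the node i0, as indicator functions of antichains of roots containing
    that node. *)
Definition fund_set (i0 : 'I_n) (s : multiexp n) :=
  (forall a, (s a <= ((val a).1 <= i0 <= (val a).2))%N) /\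
  (forall a b, root_lt a b -> (s a + s b <= 1)%N).

Lemma fund_set_matching i0 r : fund_set i0 (multideg r) -> matching i0.+1 r /\ anti r.
Proof.
move=> [s1 s2].
have cnt a : (count_mem a r <= straddle i0.+1 a)%N.
  by have := s1 a; rewrite ffunE /straddle ryE !ltnS.
have ur : uniq r.
  apply: count_mem_uniq => a; have := cnt a.
  by rewrite -has_pred1 has_count; case: (straddle _ _); case: count => [|[]].
have ar : anti r.
  move=> a b ar br; apply/negP => /s2; rewrite !ffunE.
  move: ar br; rewrite -!has_pred1 !has_count => h1 h2 h3.
  by have := leq_trans (leq_add h1 h2) h3.
split=> //; split=> // [a|a b|a b] ar'; first by
  move: ar' (cnt a); rewrite -has_pred1 has_count; case: (straddle _ _) => // h /(leq_trans h).
  move=> br' e; have ne := ar _ _ ar' br'; have ne' := ar _ _ br' ar'.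
  have [h|/ltnW h] := leqP (ry a) (ry b).
    by have := @root_lt_total _ a b; rewrite e leqnn (negPf ne) orbF => /(_ isT h) /eqP.
  by have := @root_lt_total _ b a; rewrite e leqnn (negPf ne') orbF => /(_ isT h) /eqP.
move=> br' e; have ne := ar _ _ ar' br'; have ne' := ar _ _ br' ar'.
have [h|/ltnW h] := leqP (rx a) (rx b).
  by have := @root_lt_total _ a b; rewrite e leqnn (negPf ne) orbF => /(_ h isT) /eqP.
by have := @root_lt_total _ b a; rewrite e leqnn (negPf ne') orbF => /(_ h isT) /eqP.
Qed.

Definition word_of (s : multiexp n) := flatten [seq nseq (s a) a | a <- enum {: posroot n}].

Lemma multideg_word_of s : multideg (word_of s) = s.
Proof.
apply/ffunP => a; rewrite ffunE /word_of count_flatten -map_comp sumnE big_map big_enum /=.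
rewrite (bigD1 a) //= big1 => [|b ba]; rewrite count_nseq /=; first by rewrite eqxx mul1n addn0.
by rewrite (negPf ba).
Qed.

Lemma sum_delta (i0 : 'I_n) (Q : pred 'I_n) : (\sum_(k < n | Q k) (k == i0) = Q i0)%N.
Proof.
rewrite big_mkcond (bigD1 i0) //= eqxx big1 ?addn0 => [|k /negPf ->]; first by case: (Q i0).
by case: (Q k).
Qed.

(** The coordinate attached to s is the extremal tensor of its matching: words of multidegree s have
    coefficient 1 there, and any word reaching it is compared with s by [matching_cost]. *)
Lemma model_fund (i0 : 'I_n) :
  model (fun k => k == i0 : nat) (fund_set i0) (fund_vec C n i0.+1).
Proof.
have kn : (i0 < n)%N by [].
split.
- move=> x xP; rewrite (act_fund kn) => [|a b ka bk]; last first.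
    by apply: xP; apply: leq_trans ka.
  congr (_ *: _); rewrite (bigD1 i0) //= eqxx mul1r [X in _ + X]big1 ?addr0 => [|k /negPf ->]; last by rewrite mul0r.
  under [RHS]eq_bigl => j do rewrite -ltnS.
  by rewrite (big_ord_narrow (leqW kn)).
- move=> a N aN; apply: (word_fund_power C kn); apply: leq_trans aN.
  rewrite sum_delta /straddle ryE !ltnS; exact: leqnn.
move=> s fs; pose r0 := word_of s.
have [mr0 ar0] : matching i0.+1 r0 /\ anti r0.
  by apply: fund_set_matching; rewrite multideg_word_of.
exists (matching_fun kn r0) => r; split=> [n0|er]; last first.
  have pm : perm_eq r r0 by apply/perm_multideg; rewrite multideg_word_of.
  have mr : matching i0.+1 r by case: (@fund_set_matching i0 r) => //; rewrite er.
  by rewrite (eq_matching_fun kn (r' := r)) ?word_matching ?ltr01 // => a; rewrite (perm_mem pm).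
have [|h1 h2] := matching_cost (r := r) mr0 ar0 kn.
  (* Both words reach the same tensor, so comparing their balances eliminates the indices of the
     tensor. *)
  move=> i; have := word_fund_hist i n0.
  have := @word_fund_hist C n i0.+1 r0 (matching_fun kn r0) i.
  rewrite word_matching // oner_neq0 => /(_ isT); lia.
rewrite -(multideg_word_of s) -/r0 -!cost_multideg; split=> // /h2 /perm_multideg; exact.
Qed.

End Models.

(** * Minkowski decomposition *)

Section Minkowski.
Local Open Scope nat_scope.
Variable n : nat.
Implicit Types (a b : posroot n) (l : seq (posroot n)) (m : 'I_n -> nat) (s : multiexp n).

(* Unlike a Dyck path, a chain may be restricted to the support of s. *)
Definition chain_set m s := forall l, sorted (@root_lt n) l -> forall p q : nat,
  {in l, forall a, (p <= (val a).1) && ((val a).2 <= q)} ->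
  \sum_(a <- l) s a <= \sum_(k < n | p <= k <= q) m k.

Lemma dyck_stepE a b : dyck_step a b =
  ((val b).1 == (val a).1) && ((val b).2 == (val a).2.+1 :> nat) ||
  ((val b).1 == (val a).1.+1 :> nat) && ((val b).2 == (val a).2).
Proof. by rewrite /dyck_step; case: a b => [[? ?] ?] [[? ?] ?]. Qed.

(** The second coordinate is raised first, so that every intermediate pair is still a positive
    root. *)
Lemma dyck_segment a b : (val a).1 <= (val b).1 -> (val a).2 <= (val b).2 ->
  exists c, path (@dyck_step n) a c /\ last a c = b.
Proof.
have arith2 (x y z d : nat) : x + (y - z) < d.+1 -> z < y -> x + (y - z.+1) < d by lia.
have arith1 (x y z d : nat) : (y - z) + x < d.+1 -> z < y -> (y - z.+1) + x < d by lia.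
have [d] := ubnP (((val b).1 - (val a).1) + ((val b).2 - (val a).2)).
elim: d a => // d IH a le_d h1 h2.
have b12 : (val b).1 <= (val b).2 by case: (b).
have [lt2|ge2] := ltnP (val a).2 (val b).2.
  have hq : (val a).2.+1 < n by apply: leq_ltn_trans lt2 _.
  have pq : (val a).1 <= Ordinal hq by rewrite /= leqW //; case: (a).
  have [||| c [pc lc]] := IH (mkroot pq).
  - exact: arith2 le_d lt2.
  - by [].
  - by [].
  exists (mkroot pq :: c); split=> //=; by rewrite pc andbT dyck_stepE /= !eqxx.
have [lt1|ge1] := ltnP (val a).1 (val b).1; last first.
  exists [::]; split=> //=; apply: rxy_inj; first by apply/eqP; rewrite /= eqn_leq h1.
  by rewrite !ryE; congr _.+1; apply/eqP; rewrite eqn_leq h2.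
have hp : (val a).1.+1 < n by apply: leq_ltn_trans lt1 _.
have pq : Ordinal hp <= (val a).2 by apply: leq_trans lt1 (leq_trans b12 ge2).
have [||| c [pc lc]] := IH (mkroot pq).
- exact: arith1 le_d lt1.
- by [].
- by [].
exists (mkroot pq :: c); split=> //=; by rewrite pc andbT dyck_stepE /= !eqxx orbT.
Qed.

Lemma dyck_fill a c : path (@root_lt n) a c ->
  exists d, [/\ path (@dyck_step n) a d, last a d = last a c & {subset c <= d}].
Proof.
elim: c a => [|b c IH] a /=; first by exists [::].
move=> /andP[ab pc]; have [d [pd ld sd]] := IH _ pc.
have /and3P[h1 h2 nab] := ab; have [e [pe le]] := dyck_segment h1 h2.
exists (e ++ d); split; rewrite ?cat_path ?last_cat ?le ?pe //.
move=> x; rewrite inE mem_cat => /predU1P[->|/sd ->]; last by rewrite orbT.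
case: e le {pe} => [|y e] /= le; first by rewrite le eqxx in nab.
by rewrite -le mem_last.
Qed.

Lemma leq_sum_uniq l l' s : uniq l -> uniq l' -> {subset l <= l'} ->
  \sum_(a <- l) s a <= \sum_(a <- l') s a.
Proof.
move=> ul ul' sub; rewrite !big_uniq // big_mkcond [X in _ <= X]big_mkcond /=.
by apply: leq_sum => a _; case: ifP => // /sub ->.
Qed.

(** The chain is completed to a Dyck path running from the simple root at the start of its first
    root to the one at the end of its last root; this can only increase the sum of s. *)
Lemma S_lambda_chain m s : S_lambda m s -> chain_set m s.
Proof.
move=> sS [|a c] sc p q hl; first by rewrite big_nil.
have [d [pd ld sd]] := dyck_fill sc.
set b := last a c in ld *; set i := (val a).1; set j := (val b).2.
have [e [pe le]] : exists e, path (@dyck_step n) (mkroot (leqnn i)) e /\ last (mkroot (leqnn i)) e = a.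
  by apply: dyck_segment; [exact: leqnn|exact: (valP a)].
have [f [pf lf]] : exists e, path (@dyck_step n) b e /\ last b e = mkroot (leqnn j).
  by apply: dyck_segment; [exact: (valP b)|exact: leqnn].
set a0 := mkroot _ in pe le; have [r rE] : exists r, r = e ++ d ++ f by exists (e ++ d ++ f).
have pr : path (@dyck_step n) a0 r by rewrite rE !cat_path pe le pd ld pf.
have lr : last a0 r = mkroot (leqnn j) by rewrite rE !last_cat le ld lf.
have dp : dyck_path i j (a0 :: r).
  apply/and4P; split=> //; [exact: eqxx|by rewrite /is_simple lr; exact: eqxx|].
  case: r {rE} pr lr => //= x r /andP[a0x pr] lr.
  have /allP h := order_path_min (@root_lt_trans n) (sub_path (@dyck_step_lt n) pr).
  have : root_lt a0 (mkroot (leqnn j)).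
    rewrite -lr; have := mem_last x r; rewrite inE => /predU1P[->|/h].
      exact: dyck_step_lt.
    exact/root_lt_trans/dyck_step_lt.
  case/and3P=> /= ij _; rewrite ltn_neqAle ij andbT; apply: contraNneq => eij.
  by apply/eqP/rxy_inj; [exact: eij|rewrite !ryE; congr _.+1; exact: eij].
apply: leq_trans (leq_trans (sS _ _ _ dp) _).
  apply: leq_sum_uniq.
  - exact: (sorted_root_uniq sc).
  - exact/sorted_root_uniq/dyck_sorted/dp.
  move=> x; rewrite !inE => /predU1P[->|/sd xd].
    rewrite rE catA mem_cat; case: e le {pe pr rE lr r dp} => [|y e] /= le.
      by rewrite le eqxx.
    by rewrite -le -cat_cons mem_cat mem_last !orbT.
  by rewrite rE !mem_cat xd !orbT.
rewrite big_mkcond [X in _ <= X]big_mkcond /=; apply: leq_sum => k _.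
have /andP[pi _] := hl a (mem_head _ _).
have /andP[_ jq] := hl b (mem_last _ _).
case: ifP => // /andP[ik kj].
by rewrite (leq_trans pi ik) (leq_trans kj jq).
Qed.

(** * Splitting off one fundamental weight *)

Section Subtract.
Variables (m m' : 'I_n -> nat) (i : 'I_n) (s : multiexp n).
Hypothesis mE : forall k, m k = (k == i) + m' k.
Hypothesis m_min : forall k : 'I_n, k < i -> m k = 0.
Hypothesis sS : chain_set m s.

Let inR a := (val a).1 <= i <= (val a).2.

(* The minimal elements of the support of s lying over the node i. *)
Definition min_part : multiexp n := [ffun a =>
  nat_of_bool [&& 0 < s a, inR a & [forall b, inR b && (0 < s b) ==> ~~ root_lt b a]]].
Definition rest_part : multiexp n := [ffun a => s a - min_part a].

Lemma min_part_leq a : min_part a <= s a.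
Proof. by rewrite ffunE; have [->|sa] := posnP (s a); last exact: leq_trans (leq_b1 _) sa. Qed.

Lemma madd_parts : s = madd min_part rest_part.
Proof. by apply/ffunP => a; rewrite [RHS]ffunE [rest_part a]ffunE subnKC // min_part_leq. Qed.

Lemma fund_set_min_part : fund_set i min_part.
Proof.
split=> [a|a b ab].
  by rewrite ffunE -/(inR a); case: (inR a); rewrite ?andbF ?leqn0 //; apply: leq_b1.
rewrite !ffunE; case: and3P => [[sa ra _]|_]; last exact: leq_b1.
case: and3P => // -[_ _ /forallP/(_ a)].
by rewrite ra sa /= ab.
Qed.

(** If [p, q] misses i, then m and m' have the same sum over it. If the chain meets [min_part], its
    sum drops by at least one. Otherwise let x be its first root in the support of s. If x starts
    after i, the interval shrinks to [i+1, q]; x cannot end before i, where m vanishes; if x lies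
    over i, it is not minimal, and prepending a smaller root b of the support yields the missing
    unit. *)
Lemma chain_set_rest_part : chain_set m' rest_part.
Proof.
move=> l sl p q hl.
have rs a : rest_part a <= s a by rewrite [rest_part a]ffunE leq_subr.
have [/andP[pi iq]|npq] := boolP (p <= i <= q); last first.
  have -> : \sum_(k < n | p <= k <= q) m' k = \sum_(k < n | p <= k <= q) m k.
    apply: eq_bigr => k kpq; rewrite mE; case: eqP => // e.
    by rewrite -e kpq in npq.
  by apply: leq_trans (sS sl hl); apply: leq_sum => a _; apply: rs.
have sum_m : \sum_(k < n | p <= k <= q) m k = (\sum_(k < n | p <= k <= q) m' k).+1.
  rewrite (eq_bigr _ (fun k _ => mE k)) big_split /= sum_delta pi iq; exact: add1n.
have sum_s : \sum_(a <- l) s a = \sum_(a <- l) min_part a + \sum_(a <- l) rest_part a.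
  by rewrite -big_split; apply: eq_bigr => a _; rewrite {1}madd_parts ffunE.
have [/hasP[x xl x1]|/hasPn no1] := boolP (has (fun a => 0 < min_part a) l).
  have := sS sl hl; rewrite sum_m sum_s (big_rem x) //=.
  set A := min_part x in x1 *; set B := \sum_(y <- rem x l) _; set D := \sum_(a <- l) _.
  set E := \sum_(k < n | _) _; lia.
have -> : \sum_(a <- l) rest_part a = \sum_(a <- l) s a.
  rewrite sum_s [X in X + _]big_seq [X in X + _]big1 // => a /no1.
  by rewrite lt0n negbK => /eqP.
set l' := [seq a <- l | 0 < s a].
have -> : \sum_(a <- l) s a = \sum_(a <- l') s a.
  rewrite /l' big_filter [RHS]big_mkcond; apply: eq_bigr => a _.
  by case: posnP.
have sl' : sorted (@root_lt n) l' by apply: sorted_filter => //; apply: root_lt_trans.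
have hl' : {in l', forall a, [/\ 0 < s a, a \in l & (p <= (val a).1) && ((val a).2 <= q)]}.
  by move=> a; rewrite mem_filter => /andP[sa al]; split=> //; apply: hl.
case El: l' sl' hl' => [|x l2] sl' hl'; first by rewrite big_nil.
have [sx xl /andP[px xq]] := hl' x (mem_head _ _).
have xmin y : y \in x :: l2 -> ((val x).1 <= (val y).1) && ((val x).2 <= (val y).2).
  rewrite inE => /predU1P[->|yl]; first by rewrite !leqnn.
  have /allP/(_ _ yl)/and3P[-> ->] // := order_path_min (@root_lt_trans n) sl'.
have [ix|xi] := ltnP i (val x).1.
  apply: leq_trans (sS sl' (p := i.+1) (q := q) _) _.
    move=> y yl; have /andP[h1 _] := xmin y yl; have [_ _ /andP[_ ->]] := hl' y yl.
    by rewrite andbT (leq_trans ix).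
  rewrite big_mkcond [X in _ <= X]big_mkcond /=; apply: leq_sum => k _.
  case: ifP => // /andP[ik ->]; rewrite (leq_trans pi (ltnW ik)) mE /=.
  by rewrite -val_eqE /= gtn_eqF.
have [xi2|ix2] := ltnP (val x).2 i.
  have := sS (l := [:: x]) isT (p := (val x).1) (q := (val x).2).
  rewrite big_seq1 [X in _ <= X]big1 => [h|k /andP[_ kx]]; last first.
    by apply: m_min; apply: leq_ltn_trans xi2.
  suff : s x <= 0 by rewrite leqNgt sx.
  by apply: h => y; rewrite inE => /eqP ->; rewrite !leqnn.
have rx : inR x by rewrite /inR xi.
have := no1 x xl; rewrite ffunE sx rx /= lt0b => /forallPn[b].
rewrite negb_imply negbK => /andP[/andP[rb sb] bx].
have /and3P[b1 b2 _] := bx; have /andP[bi ib] := rb.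
have : \sum_(a <- b :: x :: l2) s a <= \sum_(k < n | p <= k <= q) m k.
  apply: leq_trans (sS (l := b :: x :: l2) _ (p := (val b).1) (q := q) _) _.
  - by rewrite /= bx.
  - move=> y; rewrite inE => /predU1P[->|yl]; first by rewrite leqnn (leq_trans b2).
    have /andP[h1 _] := xmin y yl; have [_ _ /andP[_ ->]] := hl' y yl.
    by rewrite andbT (leq_trans b1).
  (* The root b may start before p, but m vanishes on the added nodes because p <= i. *)
  rewrite big_mkcond [X in _ <= X]big_mkcond /=; apply: leq_sum => k _.
  case: ifP => // /andP[bk ->]; rewrite andbT; case: (leqP p k) => // kp.
  by rewrite m_min // (leq_trans kp).
rewrite big_cons sum_m => h; rewrite -ltnS; apply: leq_trans h.
by rewrite -add1n leq_add2r.
Qed.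

End Subtract.

End Minkowski.

(** Induction on the sum of the m_k: the fundamental weight of the first node i with m_i > 0 is
    split off, since the subtraction requires m to vanish below i. *)
Lemma ex_model (C : numClosedFieldType) n (m : 'I_n -> nat) :
  exists (P : finType) (v : tensors C n P), model m (chain_set m) v.
Proof.
have [d] := ubnP (\sum_k m k)%N; elim: d m => // d IH m; rewrite ltnS => le_d.
have [/existsP[i1 mi1]|/existsPn m0] := boolP [exists i, 0 < m i]%N; last first.
  have {m0} -> : m = fun _ => 0%N.
    by apply: funext => k; have := m0 k; rewrite lt0n negbK => /eqP.
  exists 'I_0, [ffun _ => 1]; apply: model_zero => s sS.
  apply/ffunP => a; rewrite ffunE; apply/eqP; rewrite -leqn0.
  have := sS [:: a] isT (val a).1 (val a).2; rewrite big_seq1 big1 //; apply.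
  by move=> b; rewrite inE => /eqP ->; rewrite !leqnn.
pose i := [arg min_(i < i1 | (0 < m i)%N) (i : nat)].
have [mi i_min] : (0 < m i)%N /\ forall k : 'I_n, (k < i)%N -> m k = 0%N.
  rewrite /i; case: arg_minnP => // j mj jmin; split=> // k kj.
  by apply/eqP; rewrite -leqn0 leqNgt; apply: contraL kj => /jmin; rewrite -leqNgt.
pose m' k := (m k - (k == i))%N.
have mE k : m k = ((k == i) + m' k)%N.
  by rewrite /m' subnKC //; case: eqP => // ->.
have [P [v vm]] : exists (P : finType) (v : tensors C n P), model m' (chain_set m') v.
  apply: IH; apply: leq_trans le_d.
  have -> : (\sum_k m k = \sum_k (k == i) + \sum_k m' k)%N.
    by rewrite -big_split; apply: eq_bigr => k _; apply: mE.
  by rewrite (sum_delta i xpredT) add1n.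
exists ('I_i.+1 + P)%type, (tens (fund_vec C n i.+1) v).
have -> : m = fun k => ((k == i) + m' k)%N by apply: funext.
apply: model_tens (model_fund C i) vm => s sS.
exists (min_part i s), (rest_part i s); split.
- exact: fund_set_min_part.
- by apply: chain_set_rest_part sS => // k /i_min; rewrite mE.
- exact: madd_parts.
Qed.

(** * Comparison with the tensor model *)

Section Transfer.
Variables (C : numClosedFieldType) (n : nat) (m : 'I_n -> nat).
Local Notation M := 'M[C]_n.+1.
Variables (V : lmodType C) (rho : M -> V -> V) (v : V).
Hypothesis rhoP : is_rep rho.
Hypothesis rho_irr : irreducible rho.
Hypothesis v_hw : highest_weight_vector rho (dominant_weight C m) v.
Variables (P : finType) (vT : tensors C n P).
Hypothesis vT_model : model m (chain_set m) vT.

Definition dominant_eval (x : M) : C :=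
  \sum_(k < n) (m k)%:R * \sum_(j < n.+1 | (j <= k)%N) x j j.

Lemma dominant_weightE : wt_eval (dominant_weight C m) =1 dominant_eval.
Proof.
move=> x; apply: eq_bigr => k _; congr (_ * _).
rewrite /dominant_weight summxE (bigD1 k) //= big1 ?addr0 => [|i ik].
  by rewrite mulmxnE mxE !eqxx.
by rewrite mulmxnE mxE eqxx eq_sym (negPf ik) mul0rn.
Qed.

Lemma nplus_sl (x : M) : nplus x -> sl x.
Proof. by move=> xP; rewrite /sl /= /mxtrace big1 // => i _; rewrite xP. Qed.

Lemma nminus_sl (x : M) : nminus x -> sl x.
Proof. by move=> xP; rewrite /sl /= /mxtrace big1 // => i _; rewrite xP. Qed.

Lemma traceless_upper (x : M) : upper x -> upper (traceless x).
Proof. by move=> xP i j ji; rewrite !mxE xP // sub0r -val_eqE /= gtn_eqF // mulr0n oppr0. Qed.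

Local Notation rhoV := (gl_ext rho).
Local Notation rhoT := (gl_ext (@act C n P)).

Lemma rhoV_rep : gl_rep rhoV. Proof. exact: gl_ext_rep. Qed.

Lemma act_is_rep : is_rep (@act C n P).
Proof. by have [h1 h2 h3] := act_rep C n P; split=> *; rewrite ?h2 ?h3. Qed.

Lemma rhoT_rep : gl_rep rhoT. Proof. exact/gl_ext_rep/act_is_rep. Qed.

Lemma rhoV_upper x : upper x -> rhoV x v = dominant_eval (traceless x) *: v.
Proof.
move=> xP; rewrite /gl_ext; have := traceless_upper xP; have := traceless_sl x.
move: (traceless x) => {x xP} x slx xP; have [_ v_wt v_np] := v_hw.
pose h : M := diag_mx (\row_i x i i).
have hx : cartan h.
  split; last exact: diag_mx_is_diag.
  by rewrite /sl /= mxtrace_diag -[RHS]slx; apply: eq_bigr => i _; rewrite mxE.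
have np : nplus (x - h).
  move=> i j; rewrite leq_eqVlt => /predU1P[/val_inj->|ji]; rewrite !mxE.
    by rewrite eqxx mulr1n subrr.
  by rewrite (xP _ _ ji) (_ : (i == j) = false) ?mulr0n ?subrr // -val_eqE /= gtn_eqF.
have -> : rho x v = rho (x - h) v + rho h v.
  have [_ lin2 _] := rhoP; rewrite -[rho (x - h) v]scale1r -lin2; first by rewrite scale1r subrK.
    exact: nplus_sl.
  by case: hx.
rewrite v_np // add0r v_wt // dominant_weightE; congr (_ *: _).
by apply: eq_bigr => k _; congr (_ * _); apply: eq_bigr => j _; rewrite !mxE eqxx mulr1n.
Qed.

Lemma rhoT_upper x : upper x -> rhoT x vT = dominant_eval (traceless x) *: vT.
Proof. by move=> xP; rewrite /gl_ext (model_upper vT_model) //; apply: traceless_upper. Qed.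

Definition rho2 x (z : V * tensors C n P) : V * tensors C n P := (rhoV x z.1, rhoT x z.2).
Let z0 : V * tensors C n P := (v, vT).

Lemma rho2_rep : gl_rep rho2.
Proof.
have [a1 a2 a3] := rhoV_rep; have [b1 b2 b3] := rhoT_rep.
split=> [x c [u t] [u' t']|c x y [u t]|x y [u t]]; apply/pair_equal_spec; split => /=.
- exact: a1.
- exact: b1.
- exact: a2.
- exact: b2.
- exact: a3.
- exact: b3.
Qed.

Lemma dominant_eval_nplus x : nplus x -> dominant_eval x = 0.
Proof.
by move=> xP; rewrite /dominant_eval big1 // => k _; rewrite big1 ?mulr0 // => j _; rewrite xP.
Qed.

Lemma nplus_upper (x : M) : nplus x -> upper x.
Proof. by move=> xP i j ji; apply/xP/ltnW. Qed.

Lemma rhoV_hw x : upper x -> exists c, rhoV x v = c *: v.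
Proof. by move=> xP; eexists; apply: rhoV_upper. Qed.

Lemma rho2_hw x : upper x -> exists c, rho2 x z0 = c *: z0.
Proof.
move=> xP; exists (dominant_eval (traceless x)).
by rewrite /rho2 /= rhoV_upper // rhoT_upper.
Qed.

Lemma rhoV_nplus x : nplus x -> rhoV x v = 0.
Proof.
move=> xP; rewrite rhoV_upper; last exact: nplus_upper.
by rewrite traceless_id ?dominant_eval_nplus ?scale0r //; apply: nplus_sl.
Qed.

Lemma rhoT_nplus x : nplus x -> rhoT x vT = 0.
Proof.
move=> xP; rewrite rhoT_upper; last exact: nplus_upper.
by rewrite traceless_id ?dominant_eval_nplus ?scale0r //; apply: nplus_sl.
Qed.

Local Notation fV := (filt rhoV v).
Local Notation fT := (filt rhoT vT).
Local Notation f2 := (filt rho2 z0).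

(** The submodule of V x T generated by the pair of highest weight vectors. *)
Definition graph z := exists d, f2 d z.

Lemma graph_lin c z z' : graph z -> graph z' -> graph (c *: z + z').
Proof.
move=> [d hd] [d' hd']; exists (maxn d d'); apply: filt_lin.
  exact: filt_leq (leq_maxl _ _) hd.
exact: filt_leq (leq_maxr _ _) hd'.
Qed.

Lemma graph_rho x z : graph z -> graph (rho2 x z).
Proof. by move=> [d hd]; exists d.+1; apply: (filt_rho rho2_rep rho2_hw). Qed.

Lemma word2 K (g : K -> M) r : word rho2 z0 g r = (word rhoV v g r, word rhoT vT g r).
Proof. by elim: r => //= k r ->. Qed.

Lemma graph_word K (g : K -> M) r : graph (word rhoV v g r, word rhoT vT g r).
Proof. by rewrite -word2; exists (size r); apply: (word_filt rho2_rep rho2_hw). Qed.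

Lemma graph_filtT z : graph z -> exists d, fT d z.2.
Proof.
case=> d hd; exists d; elim: hd => {d z} [d|d|d c z z' _ h _ h'|d x z xP _ h|d z _ h] /=.
- exact: filt_zero.
- exact: filt_gen.
- exact: filt_lin.
- exact: filt_low.
- exact: filt_succ.
Qed.

(* Its eigenvalues separate v from the words of positive length. *)
Definition height_mx : M := diag_mx (\row_(j < n.+1) - j%:R).
Let H := rhoV height_mx.
Let mu0 := dominant_eval (traceless height_mx).

Let Hv : H v = mu0 *: v.
Proof.
apply: rhoV_upper => i j ji; rewrite mxE.
by rewrite -val_eqE /= gtn_eqF // mulr0n.
Qed.

Lemma bracket_height a : bracket height_mx (root_mx C a) = - (ry a - rx a)%:R *: root_mx C a.
Proof.
rewrite /bracket /root_mx mul_diag_mx mul_mx_diag; apply/matrixP=> i j; rewrite !mxE.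
have [->|] := eqVneq i (ry a); have [->|] := eqVneq j (rx a); rewrite ?(mulr0, mul0r, subrr) //=.
by rewrite natrB ?(ltnW (rx_lt_ry a)) //; ring.
Qed.

(** Every letter lowers the eigenvalue by the positive integer [ry a - rx a], which is nonzero in
    C. *)
Lemma height_word a r : exists2 mu, mu != mu0 &
  H (word rhoV v (@root_mx C n) (a :: r)) = mu *: word rhoV v (@root_mx C n) (a :: r).
Proof.
have Hw r' : H (word rhoV v (@root_mx C n) r') =
    (mu0 - (\sum_(a <- r') (ry a - rx a))%:R) *: word rhoV v (@root_mx C n) r'.
  elim: r' => [|b r' IH] /=; first by rewrite big_nil subr0 Hv.
  rewrite /H rep_comm ?bracket_height; last exact: rhoV_rep.
  rewrite -/H IH (repZ rhoV_rep) (rep_mxZ rhoV_rep) -scalerDl big_cons natrD.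
  by congr (_ *: _); ring.
eexists; last exact: Hw.
rewrite subr_eq -[X in X == _]addr0 (inj_eq (addrI _)) eq_sym pnatr_eq0 big_cons addn_eq0.
by rewrite negb_and -lt0n subn_gt0 rx_lt_ry.
Qed.

Definition kills (ms : seq C) (u : V) := foldr (fun mu u => H u - mu *: u) u ms.

Lemma kills_lin ms c u w : kills ms (c *: u + w) = c *: kills ms u + kills ms w.
Proof.
elim: ms => //= mu ms ->; rewrite /H (repL rhoV_rep) scalerBr scalerDr opprD addrACA.
by rewrite !scalerA [mu * c]mulrC.
Qed.

Lemma kills0 ms : kills ms 0 = 0.
Proof. by elim: ms => //= mu ms ->; rewrite /H (rep0 rhoV_rep) scaler0 subr0. Qed.

Lemma kills_one mu ms u : kills ms (H u - mu *: u) = H (kills ms u) - mu *: kills ms u.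
Proof.
elim: ms => //= mu' ms ->.
rewrite /H !(repB rhoV_rep) !(repZ rhoV_rep) !scalerBr !opprB !scalerA [mu * mu']mulrC.
by rewrite addrACA [RHS]addrACA; congr (_ + _); rewrite addrC.
Qed.

(** Being killed by a product of operators H - mu with mu != mu0 replaces membership in the sum of
    the other eigenspaces of H, without a direct sum decomposition of V. *)
Definition lowV (u : V) := exists2 ms, all (predC1 mu0) ms & kills ms u = 0.

Lemma lowV_lin c u w : lowV u -> lowV w -> lowV (c *: u + w).
Proof.
move=> [ms1 h1 e1] [ms2 h2 e2]; exists (ms1 ++ ms2); first by rewrite all_cat h1.
have C12 : kills ms1 (kills ms2 u) = kills ms2 (kills ms1 u).
  by elim: ms1 {h1 e1} => //= mu ms1 ->; rewrite kills_one.
rewrite /kills foldr_cat -/(kills ms2 _) -/(kills ms1 _) !kills_lin C12 e1 e2.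
by rewrite !kills0 scaler0 addr0.
Qed.

(** Such a product multiplies v by the nonzero scalar with factors mu0 - mu. *)
Lemma lowV_v c : lowV (c *: v) -> c = 0.
Proof.
move=> [ms hms e]; have [v0 _ _] := v_hw.
have kv : kills ms v = (\prod_(mu <- ms) (mu0 - mu)) *: v.
  elim: ms {hms e} => [|mu ms IH] /=; first by rewrite big_nil scale1r.
  rewrite IH /H (repZ rhoV_rep) -/H; rewrite Hv.
  by rewrite !scalerA -scalerBl big_cons; congr (_ *: _); ring.
move: e; rewrite -[c *: v]addr0 kills_lin kills0 addr0 kv scalerA => /eqP.
rewrite scaler_eq0 => /orP[|/eqP //]; rewrite mulf_eq0 => /orP[/eqP //|].
by rewrite prodf_seq_eq0 => /hasP[mu /(allP hms)]; rewrite /= subr_eq0 eq_sym => /negPf ->.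
Qed.

Lemma form0r (u : tensors C n P) : form u 0 = 0.
Proof. by rewrite /form big1 // => g _; rewrite ffunE conjC0 mulr0. Qed.

Lemma rhoT_adj (x y : M) u u' : (forall a b, y a b = (x b a)^*) ->
  form (rhoT x u) u' = form u (rhoT y u').
Proof.
move=> xy; apply: form_adj => a b; rewrite !mxE [RHS]rmorphB /= -xy; congr (_ - _).
have -> : \tr y = (\tr x)^* by rewrite rmorph_sum; apply: eq_bigr => i _; apply: xy.
rewrite [RHS]rmorphMn [in RHS]rmorphM /= fmorphV /= rmorph_nat; congr (_ *+ _).
by rewrite eq_sym.
Qed.

Lemma root_adj a u u' :
  form (rhoT (root_mx C a) u) u' = form u (rhoT (delta_mx (rx a) (ry a)) u').
Proof. by apply: rhoT_adj => i j; rewrite !mxE conjC_nat andbC. Qed.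

Lemma root_adj' a u u' :
  form u (rhoT (root_mx C a) u') = form (rhoT (delta_mx (rx a) (ry a)) u) u'.
Proof. by symmetry; apply: rhoT_adj => i j; rewrite !mxE conjC_nat andbC. Qed.

(** The coordinate attached to s = 0 is positive on the empty word, which is vT itself. *)
Lemma vT_neq0 : form vT vT != 0.
Proof.
apply/eqP => /form_def vT0.
have s0 : chain_set m [ffun=> 0%N].
  by move=> l _ p q _; rewrite big1 // => a _; rewrite ffunE.
have [g /(_ [::]) [_]] := model_coef vT_model s0.
rewrite /= vT0 ffunE ltxx => h; suff : false by [].
by apply: h; apply/ffunP => a; rewrite !ffunE.
Qed.

(** A word of positive length has an eigenvalue other than mu0 in V; in T it is orthogonal to vT,
    because the adjoint of its first letter lies in n^+ and kills vT. *)
Lemma graph_decomp z : graph z -> exists c z', [/\ z = c *: z0 + z', lowV z'.1 & form z'.2 vT = 0].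
Proof.
have low0 : lowV 0 by exists [::].
case=> d hd; move: hd; apply: (filt_ind_words rho2_rep (B := fun z =>
  exists c z', [/\ z = c *: z0 + z', lowV z'.1 & form z'.2 vT = 0])).
- by exists 0, 0; rewrite scale0r addr0 form0l.
- move=> c z1 z2 [c1 [z1' [-> l1 o1]]] [c2 [z2' [-> l2 o2]]].
  exists (c * c1 + c2), (c *: z1' + z2'); split.
  + by rewrite scalerDr scalerDl scalerA addrACA.
  + exact: lowV_lin.
  + by rewrite form_linl o1 o2 mulr0 addr0.
case=> [|a r] _.
  by exists 1, 0; rewrite scale1r addr0 form0l.
rewrite word2; eexists 0, _; split; first by rewrite scale0r add0r.
  have [mu mu_ne e] := height_word a r; exists [:: mu]; first by rewrite /= mu_ne.
  by rewrite /kills /= -/H -[rhoV _ _]/(word rhoV v (@root_mx C n) (a :: r)) e subrr.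
by rewrite /= root_adj rhoT_nplus ?form0r //; apply/delta_nplus/rx_lt_ry.
Qed.

(** The x with (x, 0) in the graph form a submodule. Were it all of V, decomposing (v, 0) would give
    c = 0 from the second component, and the first would put v into [lowV]. *)
Lemma graph_inj1 x : graph (x, 0) -> x = 0.
Proof.
pose W : set V := fun x => graph (x, 0).
have subW : submodule rho W.
  split.
  - by exists 0%N; apply: filt_zero.
  - move=> c u w hu hw; have := graph_lin c hu hw.
    have e : c *: (0 : tensors C n P) + 0 = 0 by rewrite scaler0 addr0.
    by move=> h; suff : graph (c *: u + w, c *: 0 + 0) by rewrite e.
  - move=> y u sly hu; have := graph_rho y hu.
    by rewrite /rho2 /= gl_ext_sl // (rep0 rhoT_rep).
have [_ /(_ W subW) [W0|WT]] := rho_irr.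
  by move=> hx; have : W x by []; rewrite W0.
have [c [[z1 z2] [[e1 e2] l1 o1]]] : exists c z', [/\ (v, 0) = c *: z0 + z', lowV z'.1 & form z'.2 vT = 0].
  by apply: graph_decomp; have : W v by rewrite WT.
have c0 : c = 0.
  have := congr1 (fun u : tensors C n P => form u vT) e2; rewrite form0l form_linl o1 addr0 => /esym/eqP.
  by rewrite mulf_eq0 (negPf vT_neq0) orbF => /eqP.
move: l1; rewrite /= -[z1]add0r -{1}(scale0r v) -{1}c0 -e1 -[v]scale1r => /lowV_v/eqP.
by rewrite oner_eq0.
Qed.

(** The kernel on T is stable under the action and, by [graph_decomp], orthogonal to vT; moving
    letters across the form makes it orthogonal to all words. As y is itself a combination of words,
    its norm vanishes. *)
Lemma graph_inj2 y : graph (0, y) -> y = 0.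
Proof.
have orth y' : graph (0, y') -> form y' vT = 0.
  move=> /graph_decomp [c [[z1 z2] [[e1 e2] l1 o1]]].
  have c0 : c = 0.
    apply/eqP; rewrite -oppr_eq0; apply/eqP/lowV_v.
    have -> : - c *: v = z1 by apply/eqP; rewrite scaleNr eq_sym -addr_eq0 addrC -e1.
    by [].
  by rewrite e2 form_linl o1 c0 mul0r addr0.
move=> hy; have [d hd] := graph_filtT hy; apply: form_def.
have: forall y', graph (0, y') -> form y' y = 0; last exact.
move: hd => /=; apply: (filt_ind_words rhoT_rep (B := fun u => forall y', graph (0, y') -> form y' u = 0)).
- by move=> y' _; apply: form0r.
- move=> c u w hu hw y' hy'; rewrite /form.
  transitivity (c^* * form y' u + form y' w); last by rewrite hu // hw // mulr0 addr0.
  rewrite /form mulr_sumr -big_split; apply: eq_bigr => g _ /=.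
  by rewrite !ffunE rmorphD rmorphM mulrDr mulrCA.
move=> r _; elim: r => [|a r IH] y' hy' /=; first exact: orth.
rewrite root_adj'; apply: IH.
by have := graph_rho (delta_mx (rx a) (ry a)) hy'; rewrite /rho2 /= (rep0 rhoV_rep).
Qed.

End Transfer.

(** * Bases and characters *)

Section FiniteBases.
Local Open Scope fset_scope.
Variables (C : fieldType) (V : lmodType C).

Lemma sum_fset_sub (I : choiceType) (F F' : {fset I}) (G : I -> V) :
  {subset F' <= F} -> \sum_(i <- F') G i = \sum_(i <- F) (if i \in F' then G i else 0).
Proof.
move=> sub; rewrite -big_mkcond -[RHS]big_filter; apply: perm_big.
apply: uniq_perm; rewrite ?filter_uniq ?fset_uniq // => i.
rewrite mem_filter; apply/idP/andP => [iF'|[]//]; split => //; exact: sub.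
Qed.

Record fin_basis (A : set V) (I : choiceType) (F : {fset I}) (b : I -> V) : Prop := FinBasis {
  fin_basis_in : forall i, i \in F -> A (b i);
  fin_basis_free : forall c : I -> C, \sum_(i <- F) c i *: b i = 0 -> forall i, i \in F -> c i = 0;
  fin_basis_gen : forall u, A u -> exists c : I -> C, u = \sum_(i <- F) c i *: b i }.

Lemma fin_basisP (A : set V) (I : choiceType) (F : {fset I}) (S : set I) b :
  (forall i, i \in F <-> S i) -> fin_basis A F b -> is_basis A S b.
Proof.
move=> FS [b_in b_free b_gen]; split=> [i /FS/b_in //|F' c sF' e i iF'|u /b_gen [c ->]].
  have sub : {subset F' <= F} by move=> j jF'; apply/FS/sF'.
  move: e; rewrite (sum_fset_sub _ sub) => e.
  have := b_free (fun j => if j \in F' then c j else 0) _ i (sub _ iF').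
  rewrite iF'; apply; rewrite -[RHS]e; apply: eq_bigr => j _.
  by case: ifP => // _; rewrite scale0r.
by exists F, c; split=> // i /FS.
Qed.

Lemma fin_basis_dim (A : set V) (I : choiceType) (F : {fset I}) b :
  fin_basis A F b -> has_dim A #|` F|.
Proof.
move=> [b_in b_free b_gen]; pose t := in_tuple F.
have t_in i : tnth t i \in F by apply: mem_tnth.
have t_inj : injective (tnth t) by apply/tuple_uniqP/fset_uniq.
have sumE (G : I -> V) : \sum_(i <- F) G i = \sum_(i < #|` F|) G (tnth t i).
  by rewrite (big_tnth _ _ F).
exists (fun i => b (tnth t i)).
have TT (i : 'I_(#|` F|)) : i \in [fset i | i : 'I_(#|` F|)] <-> [set: 'I_(#|` F|)]%classic i.
  by split=> // _; apply/imfsetP; exists i.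
have sumT (G : 'I_(#|` F|) -> V) : \sum_(i <- [fset i | i : 'I_(#|` F|)]) G i = \sum_i G i.
  rewrite -[RHS]big_enum; apply: perm_big; apply: uniq_perm; rewrite ?fset_uniq ?enum_uniq // => i.
  by rewrite mem_enum; apply/TT.
apply: (fin_basisP TT); split=> [i _|c|u /b_gen [c ->]]; first exact: b_in.
- rewrite sumT => e i _.
  pose c' j := \sum_(i | tnth t i == j) c i.
  have c'E k : c' (tnth t k) = c k.
    rewrite /c' (big_pred1 k) // => l; exact: (inj_eq t_inj).
  rewrite -c'E; apply: b_free => //; rewrite sumE -[RHS]e.
  by apply: eq_bigr => k _; rewrite c'E.
- by exists (fun i => c (tnth t i)); rewrite sumT sumE.
Qed.

End FiniteBases.

(** * Root spaces of n^- are lines *)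

Section RootVectors.
Variables (C : numFieldType) (n : nat).
Local Notation M := 'M[C]_n.+1.

Lemma bracket_cartan (h x : M) i j : cartan h ->
  bracket h x i j = (h i i - h j j) * x i j.
Proof.
move=> [_ /is_diag_mxP hd]; rewrite /bracket !mxE.
rewrite (bigD1 i) //= big1 ?addr0 => [|k ki]; last by rewrite hd ?mul0r // eq_sym.
rewrite (bigD1 j) //= [X in _ - (_ + X)]big1 ?addr0 => [|k kj]; last by rewrite hd ?mulr0.
by ring.
Qed.

Lemma wt_evalD (mu nu : weight C n) h : wt_eval (mu + nu) h = wt_eval mu h + wt_eval nu h.
Proof. by rewrite /wt_eval -big_split; apply: eq_bigr => i _; rewrite mxE mulrDl. Qed.

Lemma wt_evalN (mu : weight C n) h : wt_eval (- mu) h = - wt_eval mu h.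
Proof. by rewrite /wt_eval -sumrN; apply: eq_bigr => i _; rewrite mxE mulNr. Qed.

Lemma wt_eval0 h : wt_eval (0 : weight C n) h = 0.
Proof. by rewrite /wt_eval big1 // => i _; rewrite mxE mul0r. Qed.

Lemma wt_eval_sum I (r : seq I) (Q : pred I) (F : I -> weight C n) h :
  wt_eval (\sum_(i <- r | Q i) F i) h = \sum_(i <- r | Q i) wt_eval (F i) h.
Proof.
apply: (big_rec2 (fun a b => wt_eval a h = b)) => [|i a b _ <-]; first exact: wt_eval0.
by rewrite wt_evalD.
Qed.

Lemma mxtrace_delta_diag (l : 'I_n.+1) : \tr (delta_mx l l : M) = 1.
Proof.
rewrite /mxtrace (bigD1 l) //= mxE eqxx big1 ?addr0 // => i il.
by rewrite mxE (negPf il).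
Qed.

Lemma coroot_cartan (i : 'I_n) : cartan (coroot C i).
Proof.
split; first by rewrite /sl /= /coroot raddfB /= !mxtrace_delta_diag subrr.
apply/is_diag_mxP => j k jk; rewrite !mxE.
have jk0 l : (j == l) && (k == l) = false.
  by apply: contraNF jk => /andP[/eqP -> /eqP ->].
by rewrite !jk0 subrr.
Qed.

Lemma traceless_delta_cartan (l : 'I_n.+1) : cartan (traceless (delta_mx l l : M)).
Proof.
split; first exact: traceless_sl.
apply/is_diag_mxP => j k jk; rewrite !mxE.
have jk0 : (j == l) && (k == l) = false.
  by apply: contraNF jk => /andP[/eqP -> /eqP ->].
have -> : (j == k) = false by apply/negbTE.
by rewrite jk0 mulr0n subrr.
Qed.

Lemma posroot_weightE (a : posroot n) h : cartan h ->
  wt_eval (posroot_weight C a) h = h (rx a) (rx a) - h (ry a) (ry a).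
Proof.
move=> hc; rewrite /posroot_weight wt_eval_sum.
rewrite (eq_bigr (fun k => h (lo k) (lo k) - h (hi k) (hi k))); last first.
  by move=> k _; rewrite alpha_eval.
(* The diagonal of h is indexed by natural numbers, so that the sum of simple roots telescopes. *)
pose d k := - h (inord k) (inord k).
have dlo (k : 'I_n) : h (lo k) (lo k) = - d k.
  have -> : lo k = inord k by apply/val_inj; rewrite /= inordK // leqW.
  by rewrite opprK.
have dhi (k : 'I_n) : h (hi k) (hi k) = - d k.+1.
  have -> : hi k = inord k.+1 by apply/val_inj; rewrite /= /bump add1n inordK // ltnS.
  by rewrite opprK.
clearbody d; rewrite /rx /ry dlo dhi (eq_bigr (fun k : 'I_n => d k.+1 - d k)); last first.
  by move=> k _; rewrite dlo dhi opprK addrC.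
transitivity (\sum_((val a).1 <= k < (val a).2.+1) (d k.+1 - d k)).
  rewrite big_geq_mkord /=.
  by rewrite (big_ord_widen_cond n (fun i => (val a).1 <= i)%N (fun k => d k.+1 - d k)) //.
by rewrite telescope_sumr ?opprK 1?addrC // leqW //; case: (a).
Qed.

(** A nonzero entry (i, j) forces h_i - h_j to agree with the root on all of the Cartan subalgebra,
    which determines i and j. *)
Lemma neg_root_vectorE (a : posroot n) (x : M) : neg_root_vector a x ->
  exists2 c, c != 0 & x = c *: root_mx C a.
Proof.
move=> [xP x0 xw].
have x_supp i j : x i j != 0 -> i = ry a /\ j = rx a.
  move=> xij; have ji : (j < i)%N by rewrite ltnNge; apply: contra xij => /xP ->.
  have wt (h : M) : cartan h -> h i i - h j j = h (ry a) (ry a) - h (rx a) (rx a).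
    move=> hc; have := congr1 (fun y : M => y i j) (xw h hc).
    rewrite bracket_cartan // mxE posroot_weightE // opprB => /eqP.
    by rewrite -subr_eq0 -mulrBl mulf_eq0 (negPf xij) orbF subr_eq0 => /eqP.
  (* Traceless parts of diagonal matrix units serve as test elements; l = i and l = j locate the
     entry, as -1, 0 and 1 are distinct in C. *)
  have wt' l : (i == l)%:R - (j == l)%:R = (ry a == l)%:R - (rx a == l)%:R :> C.
    have := wt _ (traceless_delta_cartan l); rewrite !mxE !eqxx !andbb !mulr1n.
    by rewrite !opprB !addrA !subrK.
  have ne : (j == i) = false by apply/negbTE; rewrite -val_eqE /= ltn_eqF.
  have m1 : (-1 : C) != 1 by rewrite lt_eqF // (lt_trans (ltrN10 _)).
  have m0 : (-1 : C) != 0 by rewrite oppr_eq0 oner_eq0.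
  split.
    have := wt' i; rewrite eqxx ne subr0; case: eqP => // _.
    case: eqP => _ /eqP; rewrite sub0r.
      by rewrite eq_sym (negPf m1).
    by rewrite oppr0 oner_eq0.
  have := wt' j; rewrite eqxx [i == j]eq_sym ne sub0r.
  case: (_ =P _) => _; case: (_ =P _) => // _ /eqP.
    by rewrite subr0 (negPf m1).
  by rewrite subrr (negPf m0).
exists (x (ry a) (rx a)).
  apply/eqP => xa0; apply: x0; apply/matrixP=> i j; rewrite [RHS]mxE.
  by apply/eqP; apply: contraT => /[dup] nz /x_supp [ei ej]; rewrite ei ej xa0 eqxx in nz.
apply/matrixP=> i j; rewrite !mxE.
have [/x_supp [-> ->]|] := boolP (x i j != 0); first by rewrite !eqxx mulr1.
rewrite negbK => /eqP xij; rewrite xij; case: eqP => [ei|]; last by rewrite mulr0.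
case: eqP => [ej|]; last by rewrite mulr0.
by rewrite -ei -ej xij mul0r.
Qed.

End RootVectors.

(** A single root is a chain, so each s a is at most the sum of the m_k. *)
Lemma S_lambda_finite n (m : 'I_n -> nat) : finite_set (S_lambda m).
Proof.
pose B := (\sum_k m k)%N.
pose g (h : {ffun posroot n -> 'I_B.+1}) : multiexp n := [ffun a => h a : nat].
apply: (@sub_finite_set _ _ (g @` [set: {ffun posroot n -> 'I_B.+1}])%classic); last first.
  by apply: finite_image; apply: finite_finset.
move=> s sS; exists [ffun a => inord (s a)] => //.
apply/ffunP => a; rewrite !ffunE inordK // ltnS.
have := S_lambda_chain sS (l := [:: a]) isT (p := (val a).1) (q := (val a).2).
rewrite big_seq1 => h; apply: leq_trans (h _) _.
  by move=> b; rewrite inE => /eqP ->; rewrite !leqnn.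
by rewrite big_mkcond; apply: leq_sum => k _; case: ifP.
Qed.

(** Descending induction on the cost: at the coordinate attached to s, terms of larger cost have
    zero coefficient by induction, and the other terms t != s vanish there by triangularity. *)
Lemma model_free (C : numClosedFieldType) n (m : 'I_n -> nat) (S : multiexp n -> Prop)
    (P : finType) (v : tensors C n P) (F : {fset multiexp n}) (w : multiexp n -> seq (posroot n))
    (c : multiexp n -> C) : model m S v ->
  (forall s, s \in F -> S s) -> (forall s, s \in F -> multideg (w s) = s) ->
  \sum_(s <- F) c s *: word (@act C n P) v (@root_mx C n) (w s) = 0 ->
  forall s, s \in F -> c s = 0.
Proof.
move=> vm FS wF e s sF.
pose B := (\max_(t <- F) costs t)%N.
have [d] := ubnP (B - costs s); elim: d s sF => // d IH s sF sd.
have [g gP] := model_coef vm (FS s sF).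
have := congr1 (fun u : tensors C n P => u g) e; rewrite sum_ffunE ffunE.
rewrite (bigD1_seq s) ?fset_uniq //= big_seq_cond big1 ?addr0.
  rewrite ffunE => /eqP; rewrite mulf_eq0 => /orP[/eqP //|/eqP w0].
  by have := proj2 (gP (w s)) (wF s sF); rewrite w0 ltxx.
move=> t /andP[tF ts]; rewrite ffunE.
have [lt|ge] := ltnP (costs s) (costs t).
  suff -> : c t = 0 by apply: mul0r.
  apply: IH => //; move: sd; rewrite ltnS; apply: leq_trans.
  have tB : (costs t <= B)%N by apply: leq_bigmax_seq.
  exact: ltn_sub2l (leq_trans lt tB) lt.
have [->|nz] := eqVneq (word (@act C n P) v (@root_mx C n) (w t) g) 0; first exact: mulr0.
have [_] := proj1 (gP (w t)) nz.
by rewrite wF // => /(_ ge) ets; rewrite ets eqxx in ts.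
Qed.

Lemma sum_seq_count (I : finType) (U : nmodType) (r : seq I) (G : I -> U) :
  \sum_(i <- r) G i = \sum_i G i *+ count_mem i r.
Proof.
elim: r => [|j r IH]; first by rewrite big_nil big1.
rewrite big_cons IH (bigD1 j) //= [RHS](bigD1 j) //= eqxx mulrnDr mulr1n -addrA.
congr (_ + (_ + _)); apply: eq_bigr => i ij.
by rewrite eq_sym (negPf ij).
Qed.

(** * Monomial basis, dimension and character of V *)

Section Main.
Local Open Scope classical_set_scope.
Variables (C : numClosedFieldType) (n : nat) (m : 'I_n -> nat).
Local Notation M := 'M[C]_n.+1.
Variables (V : lmodType C) (rho : M -> V -> V) (v : V).
Variables (f : posroot n -> M) (w : multiexp n -> seq (posroot n)).
Let lambda := dominant_weight C m.
Hypothesis rhoP : is_rep rho.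
Hypothesis rho_irr : irreducible rho.
Hypothesis v_hw : highest_weight_vector rho lambda v.
Hypothesis fP : forall a, neg_root_vector a (f a).
Hypothesis wP : forall s, S_lambda m s -> forall a, count_mem a (w s) = s a.

Local Notation S := (S_lambda m).
Local Notation F := (fset_set S).
Local Notation b := (fun s => monomial_act rho f (w s) v).
Local Notation rhoV := (gl_ext rho).
Local Notation wd := (word rhoV v (@root_mx C n)).

Let FS s : s \in F <-> S s.
Proof. by rewrite in_fset_set; [split=> [/set_mem|/mem_set]|exact: S_lambda_finite]. Qed.

Let cf a : C := f a (ry a) (rx a).

Let cf_neq0 a : cf a != 0.
Proof. by have [c c0 e] := neg_root_vectorE (fP a); rewrite /cf e !mxE !eqxx mulr1. Qed.

Let fE a : f a = cf a *: root_mx C a.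
Proof. by have [c c0 e] := neg_root_vectorE (fP a); rewrite /cf e !mxE !eqxx mulr1. Qed.

Let root_sl (a : posroot n) : sl (root_mx C a). Proof. exact/nminus_sl/root_mx_nminus. Qed.
Let f_sl (a : posroot n) : sl (f a). Proof. by have [/nminus_sl] := fP a. Qed.

Let coef r := \prod_(a <- r) cf a.

Let coef_neq0 r : coef r != 0.
Proof. by rewrite prodf_seq_neq0; apply/allP => a _; rewrite cf_neq0. Qed.

Let monomialE r : monomial_act rho f r v = coef r *: wd r.
Proof.
have rV := gl_ext_rep rhoP.
elim: r => [|a r IH] /=; first by rewrite /coef big_nil scale1r.
rewrite IH -gl_ext_sl // fE (repZ rV) (rep_mxZ rV) scalerA /coef big_cons.
by rewrite [cf a * _]mulrC.
Qed.

(** Independence is transferred from T to V and the power relations for spanning likewise, through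
    the two injectivity statements for the graph. *)
Lemma monomial_basis : fin_basis [set: V] F b.
Proof.
have rV := gl_ext_rep rhoP.
have [P [vT vm]] := ex_model C m.
have inj1 := graph_inj1 rhoP rho_irr v_hw vm.
have inj2 := graph_inj2 rhoP v_hw vm.
have gw := graph_word rhoP v_hw vm (@root_mx C n).
have extT r : word (gl_ext (@act C n P)) vT (@root_mx C n) r =
    word (@act C n P) vT (@root_mx C n) r.
  by elim: r => //= a r ->; rewrite gl_ext_sl.
split=> // [c e s sF|u _].
  suff /eqP : c s * coef (w s) = 0 by rewrite mulf_eq0 (negPf (coef_neq0 _)) orbF => /eqP.
  pose c' s := c s * coef (w s).
  apply: (model_free (F := F) (w := w) (c := c') vm) sF => [t /FS|t /FS tS|].
  - exact: S_lambda_chain.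
  - by apply/ffunP => a; rewrite ffunE wP.
  (* The relation in V and the corresponding combination in T form a pair of the graph with first
     component 0. *)
  apply: inj2; have -> : 0 = \sum_(s <- F) c' s *: wd (w s).
    by rewrite -[LHS]e; apply: eq_bigr => t _; rewrite monomialE scalerA.
  have gs (r : seq (multiexp n)) : graph rho v vT (\sum_(s <- r) c' s *: wd (w s),
      \sum_(s <- r) c' s *: word (@act C n P) vT (@root_mx C n) (w s)).
    elim: r => [|t r IH]; first by rewrite !big_nil; exists 0%N; apply: filt_zero.
    by rewrite !big_cons; have := graph_lin (c' t) (gw (w t)) IH; rewrite extT.
  exact: gs.
pose B u := exists c : multiexp n -> C, u = \sum_(s <- F) c s *: b s.
have B0 : B 0 by exists (fun _ => 0); rewrite big1 // => s _; rewrite scale0r.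
have BL c u1 u2 : B u1 -> B u2 -> B (c *: u1 + u2).
  move=> [c1 ->] [c2 ->]; exists (fun s => c * c1 s + c2 s).
  rewrite scaler_sumr -big_split; apply: eq_bigr => s _ /=.
  by rewrite scalerDl scalerA.
have Bw : forall r, B (wd r).
  apply: (words_in_span rV (rhoV_hw rhoP v_hw) (rhoV_nplus rhoP v_hw) _ B0 BL wP).
    (* The power vanishes in the model, so the graph contains its pair with second component 0. *)
    move=> a N aN; have := gw (nseq N a).
    rewrite extT (model_power vm) // => /inj1 <-.
    by elim: (N) => //= k ->.
  move=> s sS; exists (fun t => if t == s then (coef (w s))^-1 else 0).
  rewrite (bigD1_seq s) ?fset_uniq //=; last exact/FS.
  rewrite eqxx monomialE scalerA mulVf // scale1r big1 ?addr0 // => t /negPf ->.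
  by rewrite scale0r.
(* The union of the filtration is a nonzero submodule, hence all of V by irreducibility. *)
have [d hd] : exists d, filt rhoV v d u.
  pose W : set V := fun u => exists d, filt rhoV v d u.
  have subW : submodule rho W.
    split; first by exists 0%N; apply: filt_zero.
      move=> c u1 u2 [d1 h1] [d2 h2]; exists (maxn d1 d2).
      by apply: filt_lin; [apply: filt_leq h1; apply: leq_maxl|apply: filt_leq h2; apply: leq_maxr].
    move=> x u1 slx [d h]; exists d.+1; rewrite -(gl_ext_sl _ _ slx).
    exact: (filt_rho rV (rhoV_hw rhoP v_hw)).
  have [v0 _ _] := v_hw.
  have [_ /(_ W subW) [W0|WT]] := rho_irr; last by have : W u by rewrite WT.
  have : W v by exists 0%N; apply: filt_gen.
  by rewrite W0 => /v0.
exact: (filt_ind_words rV B0 BL (fun r _ => Bw r) hd).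
Qed.

Lemma monomial_weight r : weight_space rho
  (lambda - \sum_(a <- r) posroot_weight C a) (monomial_act rho f r v).
Proof.
have rV := gl_ext_rep rhoP.
move=> h hc; have slh : sl h by case: hc.
elim: r => [|a r IH] /=.
  by rewrite big_nil subr0; have [_ + _] := v_hw; apply.
set u := monomial_act rho f r v in IH *.
have [_ _ br] := rhoP; have [_ _ fw] := fP a.
have -> : rho h (rho (f a) u) = rho (bracket h (f a)) u + rho (f a) (rho h u).
  by rewrite br // subrK.
rewrite fw // IH -(gl_ext_sl rho _ (f_sl a)) (repZ rV) -[rho (_ *: _) _]gl_ext_sl.
  rewrite (rep_mxZ rV) -scalerDl; congr (_ *: _).
  by rewrite big_cons opprD addrCA [RHS]wt_evalD wt_evalN.
  exact: gl_ext_sl.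
by rewrite /sl /= mxtraceZ (f_sl a) mulr0.
Qed.

(** The basis consists of weight vectors, so a vector of weight mu expands only in basis vectors of
    weight mu. *)
Lemma monomial_basis_weight mu : fin_basis (weight_space rho mu)
  [fset s in F | lambda - wt C s == mu]%fset b.
Proof.
have [_ b_free b_gen] := monomial_basis.
set Fmu := [fset s in F | _]%fset.
have FmuP s : s \in Fmu = (s \in F) && (lambda - wt C s == mu) by rewrite !inE.
have sub : {subset Fmu <= F} by move=> s; rewrite FmuP => /andP[].
have bw s : S s -> weight_space rho (lambda - wt C s) (b s).
  move=> sS; suff -> : wt C s = \sum_(a <- w s) posroot_weight C a by apply: monomial_weight.
  by rewrite sum_seq_count; apply: eq_bigr => a _; rewrite wP.
split=> [s|c e s sF|u u_mu].
- by rewrite FmuP => /andP[/FS/bw + /eqP <-].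
- move: e; rewrite (sum_fset_sub _ sub) => e.
  have := b_free (fun s => if s \in Fmu then c s else 0) _ s (sub _ sF).
  rewrite sF; apply; rewrite -[RHS]e; apply: eq_bigr => t _.
  by case: ifP => // _; rewrite scale0r.
have [c uE] := b_gen u I; exists c; rewrite (sum_fset_sub _ sub) uE.
apply: eq_big_seq => s sF; case: ifP => // sFmu.
suff -> : c s = 0 by rewrite scale0r.
have [i i_ne] : exists i, (lambda - wt C s) 0 i != mu 0 i.
  move: sFmu; rewrite FmuP sF /= => /eqP ne; apply: contrapT => h; apply: ne.
  apply/matrixP=> j k; rewrite ord1; apply/eqP; apply: contrapT => /negP h'; apply: h; by exists k.
have hc := coroot_cartan C i; have slh : sl (coroot C i) by case: hc.
have [lin _ _] := rhoP.
(* Applying the i-th coroot minus mu_i to u gives zero, while its coefficient at s is c s times a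
   nonzero number. *)
have e0 : \sum_(t <- F) (c t * ((lambda - wt C t) 0 i - mu 0 i)) *: b t = 0.
  have := u_mu _ hc; rewrite wt_eval_coroot uE -gl_ext_sl // (rep_sum (gl_ext_rep rhoP)).
  move/eqP; rewrite -subr_eq0 scaler_sumr -sumrB => /eqP e0; rewrite -[RHS]e0.
  apply: eq_big_seq => t /FS /bw tw.
  rewrite (repZ (gl_ext_rep rhoP)) (gl_ext_sl rho _ slh) tw // wt_eval_coroot.
  by rewrite !scalerA -scalerBl mulrBr [mu 0 i * _]mulrC.
have := b_free _ e0 s sF; move/eqP; rewrite mulf_eq0 subr_eq0 (negPf i_ne) orbF.
by move/eqP.
Qed.

Theorem monomial_basis_dim_char :
  [/\ is_basis setT S b,
      finite_set S /\ has_dim [set: V] #|` F| &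
      is_char rho (\sum_(s <- F) << lambda - wt C s >>)].
Proof.
split; first exact: fin_basisP FS monomial_basis.
  by split; [exact: S_lambda_finite|exact: fin_basis_dim monomial_basis].
move=> mu; eexists; first exact: fin_basis_dim (monomial_basis_weight mu).
have -> : #|` [fset s in F | lambda - wt C s == mu]%fset| = count (fun s => lambda - wt C s == mu) F.
  rewrite -size_filter; apply/perm_size/uniq_perm; rewrite ?filter_uniq ?fset_uniq // => s.
  by rewrite mem_filter !inE andbC.
rewrite raddf_sum /= -sum1_count -[RHS]natz natr_sum [RHS]big_mkcond /=.
by apply: eq_bigr => s _; rewrite mcoeffU; case: eqP.
Qed.

End Main.

Local Open Scope classical_set_scope.
Local Open Scope ring_scope.
Local Open Scope complex_scope.

Theorem mainTheorem3 (R : realType) (n : nat) (m : 'I_n -> nat)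
    (V : lmodType R[i]) (rho : 'M[R[i]]_n.+1 -> V -> V) (v : V)
    (f : posroot n -> 'M[R[i]]_n.+1)
    (w : multiexp n -> seq (posroot n)) :
  let lambda := dominant_weight R[i] m in
  is_rep rho -> irreducible rho -> highest_weight_vector rho lambda v ->
  (forall a, neg_root_vector a (f a)) ->
  (forall s, S_lambda m s -> forall a, count_mem a (w s) = s a) ->
  [/\ is_basis setT (S_lambda m) (fun s => monomial_act rho f (w s) v),
      finite_set (S_lambda m) /\ has_dim [set: V] #|` fset_set (S_lambda m)| &
      is_char rho (\sum_(s <- fset_set (S_lambda m)) << lambda - wt R[i] s >>)].
Proof.
move=> lambda rhoP rho_irr v_hw fP wP.
exact: (monomial_basis_dim_char rhoP rho_irr v_hw fP wP).
Qed.
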